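(* Let $M$ be a continuous-time Markov chain with i.i.d. exponential waiting times $\{W_k,\ k\in\mathbb{N}_+\}$ of parameter $\lambda>0$. Let $\alpha\in(0,1)$ and let $\sigma=\{\sigma(t),\ t\in\mathbb{R}_+\}$ be a right-continuous, almost surely strictly increasing, $\mathcal{H}$-self-similar $\alpha$-stable process (with zero location parameter), independent of $M$, with no deterministic points of discontinuity and with $\sigma(0)=0$ almost surely. Let $\psi$ be the inverse of $\sigma$, let $Y(t):=M(\psi(t))$, $t\in\mathbb{R}_+$, and let $\boldsymbol{J}_n:=(J_1,\dots,J_n)$ be the vector of the first $n$ waiting times of $Y$. Then the following hold. (1) If $\mathcal{H}=1/\alpha$ and, for every $n\in\mathbb{N}_+$ and $t_1<\dots<t_n$, the spectral measure of $(\sigma(t_1),\dots,\sigma(t_n))$ has the form $\Gamma_{\boldsymbol{t}_n}(d\boldsymbol{s})=\sum_{j=1}^nt_j\,\nu_j(d\boldsymbol{s})$ for suitable signed measures $\nu_1,\dots,\nu_n$ not depending on $t_1,\dots,t_n$, then the waiting times have joint distribution given by $$\mathbb{E}e^{i\langle\boldsymbol{\xi},\boldsymbol{J}_n\rangle}=\prod_{k=1}^n\frac{\lambda}{\lambda+\sum_{j=k}^n\mathcal{I}_j(A_n^T\boldsymbol{\xi})},\qquad\boldsymbol{\xi}\in\mathbb{R}^n,$$ where $\mathcal{I}_j(\boldsymbol{\xi})=\int_\Omega(-i\langle\boldsymbol{\xi},\boldsymbol{s}\rangle)^\alpha\,\nu_j(d\boldsymbol{s})$. (2) If $\sigma$ is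 $\mathcal{H}$-sssi (i.e. $\mathcal{H}$-self-similar with stationary increments), $\mathcal{H}\in(0,1/\alpha]$, then all the waiting times have the same marginal distribution, given by $$\mathbb{E}e^{i\xi J_1}=\lambda\int_0^\infty e^{-(-i\xi)^\alpha w^{\mathcal{H}\alpha}-\lambda w}\,dw,\qquad\xi\in\mathbb{R}.$$
   Context: $\mathbb{N}=\{0,1,2,\dots\}$, $\mathbb{N}_+=\{1,2,\dots\}$, $\mathbb{R}_+=[0,\infty)$. The chain: $M(t)=\tilde M(N(t))$, where $\tilde M=\{\tilde M(n),\ n\in\mathbb{N}\}$ is a discrete-time Markov chain and $N$ is an independent Poisson process of intensity $\lambda$ with inter-arrival times $\{W_k\}$; $\sigma$ is independent of $(\tilde M,N)$. The inverse is $\psi(t):=\inf\{s\in\mathbb{R}_+ : \sigma(s)>t\}$. The waiting times $J_k$ of $Y$ are the successive inter-arrival times of the counting process $N(\psi(t))$, i.e. $Y(t)=\tilde M(n)$ for $\sum_{k=1}^nJ_k\le t<\sum_{k=1}^{n+1}J_k$. Matrices: $I_n$ is the $n\times n$ identity; $(K_n)_{ij}=1$ if $i=j+1$ and $0$ otherwise; $A_n:=I_n-K_n$. Increasing $\alpha$-stable process: all finite-dimensional distributions are $\alpha$-stable. For $\boldsymbol{t}_n=(t_1,\dots,t_n)$ with $t_1<\dots<t_n$, the vector $(\sigma(t_1),\dots,\sigma(t_n))^T$ has characteristic function $\exp\{-\int_\Omega(-i\langle\boldsymbol{\xi},\boldsymbol{s}\rangle)^\alpha\,\Gamma_{\boldsymbol{t}_n}(d\boldsymbol{s})\}$,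 $\boldsymbol{\xi}\in\mathbb{R}^n$, where the spectral measure $\Gamma_{\boldsymbol{t}_n}$ is a finite measure on the unit sphere $\mathcal{S}^{n-1}$ of $\mathbb{R}^n$ carried by $\Omega:=\{\boldsymbol{s}\in\mathcal{S}^{n-1}: 0\le s_1\le\dots\le s_n\}$. Complex powers are principal. The signed measures $\nu_j$ in (1) live on $\Omega$ and may depend on $n$. $\sigma$ is $\mathcal{H}$-self-similar if for each $c>0$ and all $t_1,\dots,t_n\in\mathbb{R}_+$, $(\sigma(ct_1),\dots,\sigma(ct_n))\overset{d}{=}c^{\mathcal{H}}(\sigma(t_1),\dots,\sigma(t_n))$. Stationary increments: $\sigma(t+h)-\sigma(h)\overset{d}{=}\sigma(t)$ for all $t,h\in\mathbb{R}_+$.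
   Formalization: In (2) the display needs a normalization of σ (replacing σ by 2σ doubles J_1); the formal formula has exp(−m(−iξ)^α w^{Hα} − λw), where m is the total mass of the spectral measure of σ(1); m = 1 gives the printed formula. *)

(* Defs.v *)
From HB Require Import structures.
From mathcomp Require Import all_boot all_order all_algebra.
From mathcomp Require Import complex.
From mathcomp Require Import all_classical all_reals all_analysis.

Set Implicit Arguments.
Unset Strict Implicit.
Unset Printing Implicit Defensive.

Import Order.TTheory GRing.Theory Num.Theory.
Import numFieldNormedType.Exports.

Local Open Scope classical_set_scope.
Local Open Scope ring_scope.
Local Open Scope complex_scope.

Section complex_functions.
Context {R : realType}.

Definition cis (x : R) : R[i] := cos x +i* sin x.

Definition cexp (z : R[i]) : R[i] := (expR (complex.Re z))%:C * cis (complex.Im z).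

Definition cmod (z : R[i]) : R :=
  Num.sqrt (complex.Re z ^+ 2 + complex.Im z ^+ 2).

(* Principal argument, with values in ]-pi, pi]. *)
Definition carg (z : R[i]) : R :=
  let u := acos (complex.Re z / cmod z) in
  if 0 <= complex.Im z then u else - u.

(* Principal power z^a; since 0 `^ a = 0 for a != 0, cpow 0 a = 0 there. *)
Definition cpow (z : R[i]) (a : R) : R[i] :=
  (cmod z `^ a)%:C * cis (a * carg z).

End complex_functions.

Section complex_integrals.
Context {R : realType} d (T : measurableType d).

Definition cintegral (mu : {measure set T -> \bar R}) (D : set T) (f : T -> R[i]) : R[i] :=
  (Rintegral mu D (fun x => complex.Re (f x)))
    +i* (Rintegral mu D (fun x => complex.Im (f x))).

(* The Hahn decomposition is unique up to null sets, so the Jordan parts do not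
   depend on the choice made here. *)
Definition charge_pos (nu : {charge set T -> \bar R}) :=
  jordan_pos (projT2 (cid (projT2 (cid (Hahn_decomposition nu))))).

Definition charge_neg (nu : {charge set T -> \bar R}) :=
  jordan_neg (projT2 (cid (projT2 (cid (Hahn_decomposition nu))))).

Definition charge_cintegral (nu : {charge set T -> \bar R}) (D : set T)
    (f : T -> R[i]) : R[i] :=
  cintegral (charge_pos nu) D f - cintegral (charge_neg nu) D f.

End complex_integrals.

Section probability_notions.
Context {R : realType} d (T : measurableType d) (P : probability T R).

Definition eq_dist d' (S : measurableType d') (X Y : T -> S) :=
  forall A : set S, measurable A -> P (X @^-1` A) = P (Y @^-1` A).

Definition char_fun n (X : 'I_n -> T -> R) (xi : 'cV[R]_n) : R[i] :=
  cintegral P [set: T]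
    (fun w => cexp ('i%C * (\sum_(i < n) xi i 0 * X i w)%:C)).

Definition sigma_gen d' (S : measurableType d') I (D : set I)
    (X : I -> T -> S) : set (set T) :=
  <<s \bigcup_(i in D) preimage_set_system [set: T] (X i) measurable >>.

Definition independent_systems (F G : set (set T)) :=
  forall A B, F A -> G B -> P (A `&` B) = (P A * P B)%E.

(* Independence of (W_k)_k: it is enough to take initial segments, as the sets
   B k may be chosen to be the whole line. *)
Definition iid_exponential (lambda : R) (W : nat -> {RV P >-> R}) :=
  (forall k B, measurable B ->
     distribution P (W k) B = exponential_prob lambda B) /\
  (forall n (B : nat -> set R), (forall k, measurable (B k)) ->
     P (\bigcap_(k < n) (W k @^-1` B k)) =
     (\prod_(k < n) P (W k @^-1` B k))%E).

(* W k is the (k+1)-st inter-arrival time of the counting process C. *)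
Definition interarrival_times (C : R -> T -> nat) (W : nat -> T -> R) :=
  {ae P, forall w, forall (t : R) (n : nat), 0 <= t ->
    C t w = n <-> \sum_(k < n) W k w <= t < \sum_(k < n.+1) W k w}.

Definition poisson_process (lambda : R) (N : R -> {RV P >-> nat})
    (W : nat -> {RV P >-> R}) :=
  iid_exponential lambda W /\ interarrival_times N W.

(* Time-homogeneous chain on a general measurable state space, with an arbitrary
   initial law; for a countable discrete S this is the usual elementary Markov
   property. *)
Definition markov_chain d' (S : measurableType d') (Mt : nat -> {RV P >-> S}) :=
  exists p : R.-pker S ~> S,
  forall n (B : nat -> set S), (forall k, measurable (B k)) ->
    P (\bigcap_(k < n.+2) (Mt k @^-1` B k)) =
    (\int[P]_(w in \bigcap_(k < n.+1) (Mt k @^-1` B k)) p (Mt n w) (B n.+1))%E.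

(* X t = Mt n whenever W_1 + ... + W_n <= t < W_1 + ... + W_(n+1). *)
Definition jump_process d' (S : measurableType d') (Mt : nat -> T -> S)
    (C : R -> T -> nat) (W : nat -> T -> R) (X : R -> T -> S) :=
  (forall t w, 0 <= t -> X t w = Mt (C t w) w) /\ interarrival_times C W.

End probability_notions.

Section stable_processes.
Context {R : realType} d (T : measurableType d) (P : probability T R).

Definition nonneg_times n (t : n.-tuple R) := forall i, 0 <= tnth t i.

Definition ordered_times n (t : n.-tuple R) :=
  nonneg_times t /\ forall i j : 'I_n, (i < j)%N -> tnth t i < tnth t j.

Definition Omega n : set (n.-tuple R) :=
  [set s | [/\ \sum_(i < n) tnth s i ^+ 2 = 1,
               forall i, 0 <= tnth s i &
               forall i j : 'I_n, (i <= j)%N -> tnth s i <= tnth s j]].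

Definition stable_kernel (alpha : R) n (xi : 'cV[R]_n) (s : n.-tuple R) : R[i] :=
  cpow (- 'i%C * (\sum_(i < n) xi i 0 * tnth s i)%:C) alpha.

Definition spectral_measure (alpha : R) (sigma : R -> {RV P >-> R}) n
    (t : n.-tuple R) (Gamma : {finite_measure set (n.-tuple R) -> \bar R}) :=
  Gamma (~` Omega (n:=n)) = 0%E /\
  forall xi : 'cV[R]_n,
    char_fun P (fun i => sigma (tnth t i)) xi =
    cexp (- cintegral Gamma (Omega (n:=n)) (stable_kernel alpha xi)).

(* Stable with zero location parameter: no linear term in the exponent. *)
Definition increasing_stable_process (alpha : R) (sigma : R -> {RV P >-> R}) :=
  {ae P, forall w, forall s t : R, 0 <= s -> s < t -> sigma s w < sigma t w} /\
  forall n (t : n.-tuple R), (0 < n)%N -> ordered_times t ->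
    exists Gamma, spectral_measure alpha sigma t Gamma.

Definition self_similar (H : R) (sigma : R -> {RV P >-> R}) :=
  forall (c : R) n (t : n.-tuple R), 0 < c -> nonneg_times t ->
    eq_dist P
      (fun w => [tuple sigma (c * tnth t i) w | i < n])
      (fun w => [tuple c `^ H * sigma (tnth t i) w | i < n]).

Definition stationary_increments (sigma : R -> {RV P >-> R}) :=
  forall t h : R, 0 <= t -> 0 <= h ->
    eq_dist P (fun w => sigma (t + h) w - sigma h w) (sigma t).

Definition right_continuous_paths (sigma : R -> T -> R) :=
  {ae P, forall w, forall t : R, 0 <= t ->
    sigma s w @[s --> t^'+] --> sigma t w}.

Definition no_fixed_discontinuity (sigma : R -> T -> R) :=
  forall t : R, 0 < t -> {ae P, forall w, sigma s w @[s --> t] --> sigma t w}.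

(* The set is a.s. nonempty when sigma is self-similar and strictly increasing;
   inf takes the value 0 on the exceptional set. *)
Definition inverse_process (sigma : R -> T -> R) (t : R) (w : T) : R :=
  inf [set s : R | 0 <= s /\ t < sigma s w].

End stable_processes.

Section matrices.
Context {R : realType}.

Definition K_mx n : 'M[R]_n := \matrix_(i, j) (i == j.+1 :> nat)%:R.

Definition A_mx n : 'M[R]_n := 1%:M - K_mx n.

End matrices.
Arguments A_mx {R} n.
Arguments Omega {R} n.

(* Main.v *)
(** When [sigma] increases strictly and vanishes at [0], the [n]-th jump time of
    [N \o psi] is the left limit of [sigma] at the [n]-th jump time
    [W_1 + ... + W_n] of [N]. So if every [W_k] is rounded down to a grid, the
    increments of [sigma] between the rounded jump times converge almost surely
    to the waiting times [J_k]. As [sigma] is independent of the [W_k], the law of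
    these increments is, up to a small probability, a finite mixture of laws of
    increments of [sigma] between deterministic, strictly increasing times, whose
    weights are products of exponential masses of cells.
    In (1) the characteristic function of the increments with lengths [w_k] is the
    product of the [exp (- w_k c_k)], where [c_k] is the sum of the [I_j] over
    [j >= k]; hence the mixture factorizes, and each factor tends to
    [lambda / (lambda + c_k)].
    In (2) stationarity makes [J_k] the limit of a mixture of the [sigma b], where
    [b] is the rounded value of [W_k] alone, and self-similarity turns its
    characteristic function into a Riemann sum of the announced integral. *)
Require Import Defs.
From HB Require Import structures.
From mathcomp Require Import all_boot all_order all_algebra.
From mathcomp Require Import complex.
From mathcomp Require Import all_classical all_reals all_analysis.
From mathcomp Require Import measurable_realfun ring.

Set Implicit Arguments.
Unset Strict Implicit.
Unset Printing Implicit Defensive.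

Import Order.TTheory GRing.Theory Num.Theory.
Import numFieldNormedType.Exports.

Local Open Scope classical_set_scope.
Local Open Scope ring_scope.
Local Open Scope complex_scope.

(** The discretization stands in for conditioning on the [W_k]. Conditioning would call for joint
    measurability of [sigma] in time and outcome; on a grid only finitely many events occur, each
    independent of the sigma-algebra of [sigma]. The independence hypothesis speaks of [N] and not
    of the [W_k], which are determined by [N] only outside a null set; hence the detour through a
    trace sigma-algebra. The mesh is [1 / (m + 1)] while the range grows like [m + 1], so a single
    index both refines the cells and exhausts the half-line. The passage to
    [lambda / (lambda + c_k)] uses that [c_k] has nonnegative real part. This is not visible term by
    term, since the [nu_j] are signed: it is deduced from the positivity of the spectral measures
    for all choices of the lengths [w_k], as [(-i x)^alpha] has nonnegative real part for
    [alpha < 1]. For the equality of the marginal laws in (2), limits are available for integrals of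
    bounded continuous functions only; ramps and a generating class of rays extend the equality to
    all Borel sets. *)

(** * Integrals of bounded functions *)

Section bounded_integrable.
Context {R : realType} d (T : measurableType d).

(** Finiteness is asked of [mu D] alone, so that the lemma also serves for the Jordan parts of a
    charge, which are handled below as plain measures. *)
Lemma integrable_bounded (mu : {measure set T -> \bar R}) (D : set T) (X : T -> R) (C : R) :
  mu D \is a fin_num -> measurable D -> measurable_fun D X ->
  (forall w, D w -> `|X w| <= C) -> mu.-integrable D (EFin \o X).
Proof.
move=> muD mD mX XC; apply: measurable_bounded_integrable => //; first by rewrite ltey_eq muD.
by exists C; split; rewrite ?num_real // => M CM w Dw /=; rewrite (le_trans (XC w Dw)) ?ltW.
Qed.

Lemma bounded_integrable (mu : {finite_measure set T -> \bar R}) (D : set T)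
    (X : T -> R) (C : R) :
  measurable D -> measurable_fun D X -> (forall w, D w -> `|X w| <= C) ->
  mu.-integrable D (EFin \o X).
Proof. by move=> mD mX; apply: integrable_bounded => //; exact: fin_num_measure. Qed.

End bounded_integrable.

Section bounded_integrals.
Context {R : realType} d (T : measurableType d).
Implicit Types (X Y : T -> R) (C : R).

Lemma ae_eq_Rintegral (mu : {measure set T -> \bar R}) X Y :
  measurable_fun setT X -> measurable_fun setT Y ->
  {ae mu, forall w, X w = Y w} -> \int[mu]_w X w = \int[mu]_w Y w.
Proof.
move=> mX mY XY; congr fine.
apply: (@ae_eq_integral _ _ _ _ _ (EFin \o Y) (EFin \o X)) => //.
- by apply/measurable_EFinP; exact: mX.
- by apply/measurable_EFinP; exact: mY.
- by apply: filterS XY => w /= -> _.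
Qed.

Lemma Rintegral_cvg_bounded (mu : {finite_measure set T -> \bar R})
    (X_ : nat -> T -> R) X C :
  (forall m, measurable_fun setT (X_ m)) -> measurable_fun setT X ->
  (forall m w, `|X_ m w| <= C) ->
  {ae mu, forall w, X_ ^~ w @ \oo --> X w} ->
  \int[mu]_w X_ m w @[m --> \oo] --> \int[mu]_w X w.
Proof.
move=> mX_ mX XC XX.
have mE (Z : T -> R) : measurable_fun setT Z -> measurable_fun setT (EFin \o Z).
  by move=> mZ; exact/measurable_EFinP.
have [] := @dominated_convergence _ _ _ mu setT measurableT
  (fun m => EFin \o X_ m) (EFin \o X) (cst C%:E) (fun m => mE _ (mX_ m)) (mE _ mX).
- by apply: filterS XX => w /= Xw _; apply: cvg_EFin => //; exact: nearW.
- exact: finite_measure_integrable_cst.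
- by apply: aeW => w m _; rewrite lee_fin.
move=> iX _; rewrite -(fineK (integrable_fin_num measurableT iX)).
exact: fine_cvg.
Qed.

Lemma Rintegral_sum (mu : {measure set T -> \bar R}) (D : set T) (I : Type)
    (s : seq I) (X : I -> T -> R) :
  measurable D -> (forall i, mu.-integrable D (EFin \o X i)) ->
  \int[mu]_(w in D) (\sum_(i <- s) X i w) = \sum_(i <- s) \int[mu]_(w in D) X i w.
Proof.
move=> mD iX; elim: s => [|i s ih].
  rewrite big_nil; under eq_Rintegral do rewrite big_nil.
  by rewrite Rintegral_cst// mul0r.
rewrite big_cons; under eq_Rintegral do rewrite big_cons.
rewrite -ih RintegralD//.
rewrite (_ : EFin \o _ = fun w => (\sum_(j <- s) (X j w)%:E)%E).
  exact: (@integrable_sum _ _ _ mu D mD _ s xpredT (fun j w => (X j w)%:E) (fun j _ => iX j)).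
by apply/funext => w /=; rewrite sumEFin.
Qed.

End bounded_integrals.

Lemma Rintegral_cst_prob (R : realType) d (T : measurableType d)
  (P : probability T R) (r : R) : \int[P]__ r = r.
Proof.
rewrite Rintegral_cst// -[RHS]mulr1; congr (_ * _).
by rewrite -[RHS]/(fine 1%E); congr fine; exact: probability_setT.
Qed.

(** * Expectations restricted to an independent event *)

Section independence.
Context {R : realType} d (T : measurableType d) (P : probability T R).
Variables (A : set T) (mA : measurable A).

Let indep (X : T -> R) := forall B, measurable B ->
  P (X @^-1` B `&` A) = (P (X @^-1` B) * P A)%E.

(* The law of [X * \1_A] is the mixture of the law of [X], with weight [P A],
   and of the Dirac mass at [0]. *)
Let ge0_integral_indep (X : T -> R) : measurable_fun setT X -> indep X ->
  (forall w, 0 <= X w) ->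
  (\int[P]_w (\1_A w * X w)%:E = P A * \int[P]_w (X w)%:E)%E.
Proof.
move=> mX XA X0.
have pA0 : 0 <= fine (P A) by rewrite fine_ge0.
have pA0' : 0 <= fine (P (~` A)) by rewrite fine_ge0.
pose Z : T -> R := fun w => \1_A w * X w.
have mZ : measurable_fun setT Z by apply: measurable_funM => //; exact: measurable_indic.
(* [X] and [Z] are nonnegative, so the absolute value does not alter them; it makes the integrand
   nonnegative on the whole line, as the change of variables requires. *)
pose f : R -> \bar R := fun y => `|y|%:E.
have mf : measurable_fun [set: R] f.
  by apply/measurable_EFinP; exact: normr_measurable.
have -> : (\int[P]_w (\1_A w * X w)%:E = \int[pushforward P Z]_y f y)%E.
  rewrite ge0_integral_pushforward//=; last by move=> y _; rewrite lee_fin.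
  by apply: eq_integral => w _; rewrite /f /Z ger0_norm// mulr_ge0.
have -> : (\int[P]_w (X w)%:E = \int[pushforward P X]_y f y)%E.
  rewrite ge0_integral_pushforward//=; last by move=> y _; rewrite lee_fin.
  by apply: eq_integral => w _; rewrite /f ger0_norm.
pose X' : {RV P >-> R} := HB.pack X (isMeasurableFun.Build _ _ _ _ _ mX).
pose m1 : {measure set R -> \bar R} := mscale (NngNum pA0) (distribution P X').
pose m2 : {measure set R -> \bar R} := mscale (NngNum pA0') (dirac (0 : R)).
rewrite (@eq_measure_integral _ _ _ setT (measure_add m1 m2)).
  have f0 y : [set: R] y -> (0 <= f y)%E by move=> _; rewrite lee_fin.
  rewrite (ge0_integral_measure_add _ _ _ f0)// /m1 /m2.
  rewrite !ge0_integral_mscale// integral_dirac// diracT {2}/f normr0 !mule0 adde0.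
  by rewrite /= fineK// fin_num_measure.
have EA : P A = (fine (P A))%:E by rewrite fineK// fin_num_measure.
have EA' : P (~` A) = (fine (P (~` A)))%:E.
  by rewrite fineK// fin_num_measure//; exact: measurableC.
move=> B mB _; transitivity (m1 B + m2 B)%E; last by rewrite -measure_addE.
transitivity (P A * P (X @^-1` B) + P (~` A) * \d_(0%R : R) B)%E; last by rewrite EA EA'.
rewrite /= /pushforward.
have mXB : measurable (X @^-1` B) by rewrite -[X in measurable X]setTI; exact: (mX).
have mZB : measurable (Z @^-1` B) by rewrite -[X in measurable X]setTI; exact: (mZ).
rewrite (measureDI P mZB mA) addeC; congr (_ + _)%E.
  rewrite muleC -XA//; congr (P _); apply/seteqP; split => w /= [+ Aw].
    by rewrite /Z indicE mem_set// mul1r.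
  by rewrite /Z indicE mem_set// mul1r.
have ZA w : (~` A) w -> Z w = 0 by move=> Aw; rewrite /Z indicE memNset// mul0r.
rewrite diracE; case: (boolP (0 \in B)) => [/set_mem B0|/negP B0].
  rewrite mule1; congr (P _); apply/seteqP; split => w /=; first by case.
  by move=> Aw; split => //; rewrite ZA.
rewrite mule0 -(measure0 P); congr (P _); apply/seteqP; split => w //= [+ Aw].
by rewrite ZA// => /mem_set.
Qed.

(** Adding [C] reduces to a nonnegative variable; the constant contributes [C * P A] on both sides
    and cancels. *)
Lemma Rintegral_indep (X : T -> R) (C : R) : measurable_fun setT X ->
  (forall B, measurable B -> P (X @^-1` B `&` A) = (P (X @^-1` B) * P A)%E) ->
  (forall w, `|X w| <= C) ->
  \int[P]_w (\1_A w * X w) = fine (P A) * \int[P]_w X w.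
Proof.
move=> mX XA XC.
have X0 w : 0 <= X w + C by rewrite -lerBlDr sub0r lerNl (le_trans _ (XC w))// -normrN ler_norm.
have mXC : measurable_fun setT (fun w => X w + C) by exact: measurable_funD.
have iX : P.-integrable setT (EFin \o X).
  by apply: (@bounded_integrable _ _ _ _ _ _ C) => // w _; exact: XC.
have m1 : measurable_fun setT (\1_A : T -> R) by exact: measurable_indic.
have n1 w : `|\1_A w : R| <= 1 by rewrite indicE; case: (_ \in _); rewrite ?normr0 ?normr1.
have i1X : P.-integrable setT (EFin \o (fun w => \1_A w * X w)).
  apply: (@bounded_integrable _ _ _ _ _ _ C) => //; first exact: measurable_funM.
  by move=> w _; rewrite normrM (le_trans _ (XC w))// ler_piMl.
have XCA : indep (fun w => X w + C).
  move=> B mB; have := @XA ((fun y => y + C) @^-1` B); apply.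
  by rewrite -[X in measurable X]setTI; apply: measurable_funD.
have := ge0_integral_indep mXC XCA X0.
move/(congr1 fine); rewrite fineM ?fin_num_measure//; last first.
  apply: integrable_fin_num => //; apply: (@bounded_integrable _ _ _ P _ _ (C + C)) => //.
  by move=> w _; rewrite ger0_norm// lerD// (le_trans (ler_norm _)).
rewrite -!/(Rintegral _ _ _).
have -> : \int[P]_w (\1_A w * (X w + C)) = \int[P]_w (\1_A w * X w) + C * fine (P A).
  under eq_Rintegral do rewrite mulrDr.
  rewrite RintegralD//; last first.
    apply: (@bounded_integrable _ _ _ P _ _ `|C|) => //; first exact: measurable_funM.
    by move=> w _; rewrite normrM ler_piMl.
  congr (_ + _); rewrite RintegralZr//; last exact: (@bounded_integrable _ _ _ P _ _ 1).
  by rewrite mulrC /Rintegral integral_indic// setIT.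
rewrite RintegralD//; last exact: finite_measure_integrable_cst.
rewrite Rintegral_cst_prob mulrDr [C * _]mulrC.
by move/addIr.
Qed.
End independence.

(** * Jump times of a time-changed counting process *)

Definition psum (R : realType) (u : nat -> R) (n : nat) : R := \sum_(k < n) u k.

Lemma psumS (R : realType) (u : nat -> R) n : psum u n.+1 = psum u n + u n.
Proof. by rewrite /psum big_ord_recr. Qed.

Lemma psum0 (R : realType) (u : nat -> R) : psum u 0 = 0.
Proof. by rewrite /psum big_ord0. Qed.

Lemma psum_lt (R : realType) (u : nat -> R) : (forall k, psum u k < psum u k.+1) ->
  {homo psum u : m n / (m < n)%N >-> m < n}.
Proof.
move=> u0 m n; elim: n => // n ih; rewrite ltnS leq_eqVlt => /predU1P[->//|mn].
by rewrite (lt_trans (ih mn)).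
Qed.

Lemma psum_le (R : realType) (u : nat -> R) : (forall k, psum u k < psum u k.+1) ->
  {homo psum u : m n / (m <= n)%N >-> m <= n}.
Proof.
by move=> u0 m n; rewrite leq_eqVlt => /predU1P[->//|/(psum_lt u0)/ltW].
Qed.

Section jump_times.
Context {R : realType}.
Variables (sigma : R -> R) (N : R -> nat) (W J : nat -> R).

Let psi t := inf [set s : R | 0 <= s /\ t < sigma s].

Hypothesis sigma_lt : forall s t : R, 0 <= s -> s < t -> sigma s < sigma t.
Hypothesis sigma0 : sigma 0 = 0.
Hypothesis W_gt0 : forall k, 0 < W k.
Hypothesis N_W : forall (t : R) (n : nat), 0 <= t ->
  N t = n <-> psum W n <= t < psum W n.+1.
Hypothesis N_J : forall (t : R) (n : nat), 0 <= t ->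
  N (psi t) = n <-> psum J n <= t < psum J n.+1.

Let sigma_le (s t : R) : 0 <= s -> s <= t -> sigma s <= sigma t.
Proof. by move=> s0; rewrite le_eqVlt => /predU1P[->//|/(sigma_lt s0)/ltW]. Qed.

Let sigma_ge0 (s : R) : 0 <= s -> 0 <= sigma s.
Proof. by move=> s0; rewrite -sigma0 sigma_le. Qed.

Let psumW_lt k : psum W k < psum W k.+1.
Proof. by rewrite psumS ltrDl. Qed.

Let psumW_ge0 n : 0 <= psum W n.
Proof. by rewrite -(psum0 W) psum_le. Qed.

Let inverse_sigma (s : R) : 0 <= s -> psi (sigma s) = s.
Proof.
move=> s0; rewrite /psi; apply/eqP; rewrite eq_le; apply/andP; split.
  apply/ler_addgt0Pr => e e0; apply: ge_inf.
    by exists 0 => x [].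
  by split; [rewrite addr_ge0// ltW|apply: sigma_lt => //; rewrite ltrDl].
apply: lb_le_inf.
  by exists (s + 1); split; [rewrite addr_ge0|apply: sigma_lt => //; rewrite ltrDl].
by move=> x [x0]; apply: contraTT; rewrite -ltNge -leNgt => xs; exact/ltW/sigma_lt.
Qed.

(** At time [sigma (psum W n)] the inverse is exactly [psum W n], so the time-changed count is [n].
    The positivity of the [J k] follows from this sandwich. *)
Let jump_sandwich n : psum J n <= sigma (psum W n) < psum J n.+1.
Proof.
apply/N_J; first exact: sigma_ge0.
by rewrite inverse_sigma//; apply/N_W; rewrite // lexx psumW_lt.
Qed.

Let psumJ_lt k : psum J k < psum J k.+1.
Proof. by have /andP[] := jump_sandwich k; exact: le_lt_trans. Qed.

(** At time [sigma s] the time-changed count is [N s], which is still below [n]. *)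
Let sigma_lt_psumJ n (s : R) : 0 <= s -> s < psum W n -> sigma s < psum J n.
Proof.
move=> s0 sn; have s1 := sigma_ge0 s0.
have /N_W-/(_ s0)/andP[Ns _] : N s = N s by [].
have /N_J-/(_ s1)/andP[_] : N (psi (sigma s)) = N s by rewrite inverse_sigma.
move=> /lt_le_trans; apply; apply: psum_le => //.
rewrite ltnNge; apply/negP => /(psum_le psumW_lt) nNs.
by have := lt_le_trans sn (le_trans nNs Ns); rewrite ltxx.
Qed.

(** If [sigma] has not exceeded [t] before [psum W n], then [psi t] is at least [psum W n] and [n]
    jumps have occurred by time [t]. The last hypothesis makes the set defining [psi t] nonempty,
    which excludes the default value of [inf]. *)
Let psumJ_le n (t : R) : 0 <= t -> (forall s : R, 0 <= s -> s < psum W n -> sigma s <= t) ->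
  t < sigma (psum W n + 1) -> psum J n <= t.
Proof.
move=> t0 tn tn1.
have psi_ge : psum W n <= psi t.
  apply: lb_le_inf.
    by exists (psum W n + 1); split => //; rewrite addr_ge0.
  by move=> x [x0 tx]; rewrite leNgt; apply/negP => /(tn _ x0); rewrite leNgt tx.
have psi0 : 0 <= psi t by rewrite (le_trans _ psi_ge).
have /N_W-/(_ psi0)/andP[_ tN] : N (psi t) = N (psi t) by [].
have /N_J-/(_ t0)/andP[+ _] : N (psi t) = N (psi t) by [].
apply: le_trans; apply: psum_le => //.
rewrite -ltnS ltnNge; apply/negP => /(psum_le psumW_lt) nNs.
by have := lt_le_trans tN (le_trans nNs psi_ge); rewrite ltxx.
Qed.

(* No continuity of [sigma] is needed: [psum W n <= psi t] means that
   [sigma s <= t] for all [s < psum W n]. *)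
Lemma jump_time_left_limit n (a : nat -> R) : (0 < n)%N ->
  (\forall m \near \oo, 0 <= a m < psum W n) -> a @ \oo --> psum W n ->
  sigma (a m) @[m --> \oo] --> psum J n.
Proof.
move=> n0 a_lt a_cvg.
have Wn0 : 0 < psum W n by rewrite -(psum0 W) psum_lt.
apply/cvgrPdist_le => e e0.
(* Otherwise [psumJ_le] would apply at the level [psum J n - e]. That level is replaced by its
   maximum with [0] to be a legitimate time, and it stays below [psum J n] because the latter is
   positive. *)
have [s [s0 sW sJ]] : exists s, [/\ 0 <= s, s < psum W n & psum J n - e <= sigma s].
  apply: contrapT => /forallNP H.
  have He s : 0 <= s -> s < psum W n -> sigma s <= Num.max 0 (psum J n - e).
    move=> s0 sW; rewrite le_max; apply/orP; right.
    by case: (leP (sigma s) (psum J n - e)) => // /ltW sJ; case: (H s).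
  have J0 : 0 < psum J n by rewrite -sigma0 sigma_lt_psumJ.
  have : psum J n <= Num.max 0 (psum J n - e).
    apply: psumJ_le => //; first by rewrite le_max lexx.
    rewrite gt_max; apply/andP; split.
      by rewrite -sigma0 sigma_lt// (lt_trans Wn0)// ltrDl.
    have /andP[Jn _] := jump_sandwich n.
    rewrite (@le_lt_trans _ _ (sigma (psum W n)))//; last by rewrite sigma_lt// ltrDl.
    by rewrite lerBlDr (le_trans Jn)// lerDl ltW.
  by rewrite le_max leNgt J0/= lerBrDl gerDr leNgt e0.
near=> m.
have /andP[am0 amW] : 0 <= a m < psum W n by near: m.
have /ltW Jm := sigma_lt_psumJ am0 amW.
rewrite ger0_norm ?subr_ge0// lerBlDr -lerBlDl (le_trans sJ)// sigma_le//.
by apply: ltW; near: m; exact: (cvgr_gt _ a_cvg).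
Unshelve. all: by end_near. Qed.

End jump_times.

(** * Rounding to a grid *)

Section grid.
Context {R : realType}.

(* Cells are open on the left and start at [m.+1%:R^-1]: the grid point is then
   strictly below the points of its cell, as left limits require, and positive,
   so that its partial sums are ordered times. *)
Definition grid (m i : nat) : R := i.+1%:R / m.+1%:R.

Definition cell (m i : nat) : set R := `]grid m i, grid m i.+1]%classic.

(** Quadratic in [m], so that cells of width [1 / (m + 1)] reach beyond [m + 1]. *)
Definition ncell (m : nat) : nat := (m.+1 * m.+1)%N.

(** A point of the cell [i] satisfies [ceil (x * (m + 1)) = i + 2], hence the subtraction of [2].
    For [x] outside the cells the result is arbitrary, so the index is only used for large [m]. *)
Definition cell_index (m : nat) (x : R) : 'I_(ncell m).+1 :=
  inord (`|Num.ceil (x * m.+1%:R)| - 2).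

Lemma grid_gt0 m i : 0 < grid m i.
Proof. by rewrite divr_gt0. Qed.

Lemma gridS m i : grid m i.+1 = grid m i + m.+1%:R^-1.
Proof. by rewrite /grid -natr1 mulrDl mul1r. Qed.

Lemma cellP m i (x : R) : cell m i x <-> i.+1%:R < x * m.+1%:R <= i.+2%:R.
Proof. by rewrite /cell/= in_itv/= ltr_pdivrMr// ler_pdivlMr. Qed.

Lemma cell_uniq m i j (x : R) : cell m i x -> cell m j x -> i = j.
Proof.
move=> /cellP/andP[ix xi] /cellP/andP[jx xj].
have := lt_le_trans ix xj; have := lt_le_trans jx xi.
by rewrite !ltr_nat !ltnS => ij ji; apply/eqP; rewrite eqn_leq ij ji.
Qed.

Lemma measurable_cell m i : measurable (cell m i).
Proof. exact: measurable_itv. Qed.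

Lemma near_cell_index (x : R) : 0 < x ->
  \forall m \near \oo, cell m (cell_index m x) x.
Proof.
move=> x0; near=> m.
have xm1 : 1 < x * m.+1%:R.
  rewrite -ltr_pdivrMl// mulr1 -natr1.
  by rewrite ltr_wpDr//; near: m; exact: nbhs_infty_gtr.
have xm : x <= m.+1%:R.
  by rewrite -natr1 ler_wpDr// ltW//; near: m; exact: nbhs_infty_gtr.
set y := x * m.+1%:R in xm1 *.
have : (1 < Num.ceil y)%R by rewrite ceil_gt_int.
have := ceil_itv y; case cE: (Num.ceil y) => [[|[|c]]|] //.
rewrite -[c.+2]addn1 PoszD addrK => /andP[cy yc] _.
have iE : (cell_index m x : nat) = c.
  rewrite /cell_index -/y cE inordK absz_nat subn2// ltnS.
  rewrite -(ler_nat R) (@le_trans _ _ y)//; last by rewrite natrM ler_wpM2r.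
  by apply/ltW; apply: le_lt_trans cy; rewrite ler_nat.
by apply/cellP; rewrite iE; apply/andP; split=> //; move: yc; rewrite -PoszD addn1.
Unshelve. all: by end_near. Qed.

End grid.

Section grid_times.
Context {R : realType}.
Variables (n m : nat).
Implicit Types f : {ffun 'I_n -> 'I_(ncell m).+1}.

Definition grid_time f (k : nat) : R := \sum_(l < n | (l < k)%N) grid m (f l).

Lemma grid_time0 f : grid_time f 0 = 0.
Proof. by rewrite /grid_time big_pred0. Qed.

Lemma grid_timeS f (k : 'I_n) : grid_time f k.+1 = grid_time f k + grid m (f k).
Proof.
rewrite /grid_time (bigD1 k)//= addrC; congr (_ + _); apply: eq_bigl => l.
by rewrite ltnS ltn_neqAle andbC.
Qed.

Lemma grid_time_ge0 f k : 0 <= grid_time f k.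
Proof. by apply: sumr_ge0 => l _; exact/ltW/grid_gt0. Qed.

Lemma grid_time_near f (u : nat -> R) k : (k <= n)%N ->
  (forall l : 'I_n, cell m (f l) (u l)) ->
  psum u k - n%:R / m.+1%:R <= grid_time f k <= psum u k.
Proof.
move=> kn fu; have psumE : psum u k = \sum_(l < n | (l < k)%N) u l.
  by rewrite /psum (big_ord_widen _ u kn).
rewrite psumE; apply/andP; split; last first.
  by apply: ler_sum => l _; have := fu l; rewrite /cell/= in_itv/= => /andP[/ltW].
rewrite lerBlDr -lerBlDl -sumrB (@le_trans _ _ (\sum_(l < n | (l < k)%N) m.+1%:R^-1))//.
  apply: ler_sum => l _; have := fu l; rewrite /cell/= in_itv/= gridS => /andP[_].
  by rewrite lerBlDl.
rewrite (@le_trans _ _ (\sum_(l < n) m.+1%:R^-1))//.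
  by rewrite [leRHS](bigID (fun l : 'I_n => (l < k)%N))/= lerDl sumr_ge0.
by rewrite sumr_const card_ord mulrC mulr_natr.
Qed.

(** Strictness comes from the last cell alone, which is open on the left; this is why [k] must be
    positive. *)
Lemma grid_time_lt f (u : nat -> R) k : (0 < k <= n)%N ->
  (forall l : 'I_n, cell m (f l) (u l)) -> grid_time f k < psum u k.
Proof.
case: k => // k /= kn fu.
rewrite (grid_timeS _ (Ordinal kn)) psumS ler_ltD//.
  by have /andP[] := grid_time_near (ltnW kn) fu.
by have := fu (Ordinal kn); rewrite /cell/= in_itv/= => /andP[].
Qed.

End grid_times.

(** * Discretization of the waiting times *)

Lemma sum_indic_disjoint (R : realType) (T : Type) (I : finType) (A : I -> set T)
    (X : I -> R) (w : T) (i : I) :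
  (forall j, A j w -> j = i) -> A i w -> \sum_j \1_(A j) w * X j = X i.
Proof.
move=> Ai Aiw; rewrite (bigD1 i)//= indicE mem_set// mul1r big1 ?addr0// => j ji.
by rewrite indicE memNset ?mul0r// => /Ai /eqP; rewrite (negbTE ji).
Qed.

Lemma measurable_fun_sigma_gen d (T : measurableType d) d' (S : measurableType d')
    (I : Type) (D : set I) (X : I -> T -> S) (i : I) : D i ->
  measurable_fun [set: g_sigma_algebraType
    (\bigcup_(i in D) preimage_set_system [set: T] (X i) measurable)] (X i).
Proof.
move=> Di _ B mB; apply: sub_sigma_algebra; exists i => //.
by exists B; rewrite // setTI.
Qed.

Section discretization.
Context {R : realType} d (T : measurableType d) (P : probability T R).
Variables (sigma : R -> T -> R) (W J : nat -> T -> R) (p : set R -> R).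

Hypothesis m_sigma : forall t, measurable_fun setT (sigma t).
Hypothesis m_W : forall k, measurable_fun setT (W k).
Hypothesis m_J : forall k, measurable_fun setT (J k).
Hypothesis W_gt0 : {ae P, forall w, forall k, 0 < W k w}.
Hypothesis sigma0 : {ae P, forall w, sigma 0 w = 0}.
Hypothesis J_limit : {ae P, forall w, forall (n : nat) (a : nat -> R), (0 < n)%N ->
  (\forall m \near \oo, 0 <= a m < psum (W^~ w) n) -> a @ \oo --> psum (W^~ w) n ->
  sigma (a m) w @[m --> \oo] --> psum (J^~ w) n}.
Hypothesis W_indep : forall n (B : nat -> set R), (forall k, measurable (B k)) ->
  P (\bigcap_(k < n) (W k @^-1` B k)) = (\prod_(k < n) p (B k))%:E.
Hypothesis W_sigma : forall F n (B : nat -> set R), (forall k, measurable (B k)) ->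
  sigma_gen [set t : R | 0 <= t] sigma F ->
  P (F `&` \bigcap_(k < n) (W k @^-1` B k)) =
  (P F * P (\bigcap_(k < n) (W k @^-1` B k)))%E.

Variables (g : R -> R) (C : R) (n : nat) (c : 'I_n -> R).
Hypotheses (g_cont : continuous g) (g_bounded : forall x, `|g x| <= C).

Local Notation index m := {ffun 'I_n -> 'I_(ncell m).+1}.

Let increments m (f : index m) (w : T) : R :=
  \sum_(k < n) c k * (sigma (grid_time f k.+1) w - sigma (grid_time f k) w).

(** The independence hypotheses quantify over sequences of sets, so the finite family of cells is
    completed by the whole line. *)
Let box m (f : index m) (k : nat) : set R :=
  if insub k is Some i then cell m (f i) else setT.

Let event m (f : index m) : set T :=
  \bigcap_(k < n) (W k @^-1` box f k).

Let eventP m (f : index m) w :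
  event f w <-> forall l : 'I_n, cell m (f l) (W l w).
Proof.
split=> [fw l|fw k /= kn].
  by have := fw l (ltn_ord l); rewrite /box/= valK.
by rewrite /box insubT/=; exact: (fw (Ordinal kn)).
Qed.

Let measurable_box m (f : index m) k : measurable (box f k).
Proof. by rewrite /box; case: insubP => // *; exact: measurable_cell. Qed.

Let measurable_event m (f : index m) : measurable (event f).
Proof.
by apply: bigcap_measurableType => k _; rewrite -[X in measurable X]setTI; apply: m_W.
Qed.

Let prob_event m (f : index m) :
  fine (P (event f)) = \prod_(k < n) p (cell m (f k)).
Proof.
rewrite W_indep//=; apply: eq_bigr => k _; congr p.
by rewrite /box valK.
Qed.

(** The space is arbitrary because two sigma-algebras are needed: the ambient one for integration,
    and the one generated by [sigma] at nonnegative times, to which [W_sigma] applies. *)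
Let measurable_increments d0 (T0 : measurableType d0) (X : R -> T0 -> R) m (f : index m) :
  (forall t, 0 <= t -> measurable_fun setT (X t)) ->
  measurable_fun setT (fun w => g (\sum_(k < n)
    c k * (X (grid_time f k.+1) w - X (grid_time f k) w))).
Proof.
move=> mX; apply: measurableT_comp; first exact: continuous_measurable_fun.
apply: measurable_sum => k; apply: measurable_funM => //.
by apply: measurable_funB; apply: mX; exact: grid_time_ge0.
Qed.

Let indep_increments m (f : index m) B : measurable B ->
  P ((fun w => g (increments f w)) @^-1` B `&` event f) =
  (P ((fun w => g (increments f w)) @^-1` B) * P (event f))%E.
Proof.
move=> mB; apply: W_sigma => //.
pose T0 := g_sigma_algebraType
  (\bigcup_(t in [set t : R | 0 <= t]) preimage_set_system [set: T] (sigma t) measurable).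
have := @measurable_increments _ T0 sigma m f.
move=> /(_ (fun t => measurable_fun_sigma_gen (X := sigma) (i := t)))/(_ measurableT B mB).
by rewrite setTI.
Qed.

(** The events are pairwise disjoint: this is [g] of the increments between the rounded jump times,
    or [0] if some [W k] with [k < n] lies in no cell. *)
Let approx m (w : T) : R := \sum_(f : index m) \1_(event f) w * g (increments f w).

Let approxE m (f : index m) w : event f w -> approx m w = g (increments f w).
Proof.
move=> fw; apply: (sum_indic_disjoint (fun f => g (increments f w))) => //.
move=> h /eventP hw; apply/ffunP => l; apply/val_inj.
by move/eventP : fw => /(_ l) fl; exact: cell_uniq (hw l) fl.
Qed.

Let approx_bounded m w : `|approx m w| <= C.
Proof.
have [[f fw]|] := pselect (exists f : index m, event f w); first by rewrite (approxE fw).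
move=> /forallNP nfw; rewrite /approx big1 ?normr0 ?(le_trans _ (g_bounded 0))// => f _.
by rewrite indicE memNset ?mul0r.
Qed.

Let measurable_term m (f : index m) :
  measurable_fun setT (fun w => \1_(event f) w * g (increments f w)).
Proof.
apply: measurable_funM; first exact: measurable_indic.
by apply: measurable_increments => t _; exact: m_sigma.
Qed.

Let measurable_approx m : measurable_fun setT (approx m).
Proof. by apply: measurable_sum => f; exact: measurable_term. Qed.

Let integral_approx m : \int[P]_w approx m w =
  \sum_(f : index m) (\prod_(k < n) p (cell m (f k))) * \int[P]_w g (increments f w).
Proof.
rewrite Rintegral_sum//.
  apply: eq_bigr => f _; rewrite -prob_event.
  apply: (@Rintegral_indep _ _ _ _ _ _ _ C) => //.
    by apply: measurable_increments => t _; exact: m_sigma.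
  exact: indep_increments.
move=> f; apply: (@bounded_integrable _ _ _ _ _ _ C) => // w _.
rewrite normrM (le_trans _ (g_bounded (increments f w)))//.
by rewrite ler_piMl// indicE; case: (_ \in _); rewrite ?normr0 ?normr1.
Qed.

Let approx_cvg : {ae P, forall w, approx ^~ w @ \oo --> g (\sum_(k < n) c k * J k w)}.
Proof.
apply: filterS (filterI W_gt0 (filterI sigma0 J_limit)) => w [W0 [s0 Jl]].
pose h m : index m := [ffun k : 'I_n => cell_index m (W k w)].
have hw : \forall m \near \oo, forall l : 'I_n, cell m (h m l) (W l w).
  by apply: filter_forall => l; apply: filterS (near_cell_index (W0 l)) => m; rewrite ffunE.
have sigma_cvg k : (k <= n)%N ->
    sigma (grid_time (h m) k) w @[m --> \oo] --> psum (J^~ w) k.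
  (* [J_limit] speaks of positive indices only, as no time lies strictly below the zeroth jump;
     there the grid time is [0] and [sigma] vanishes. *)
  case: k => [_|k kn].
    rewrite psum0; under eq_cvg do rewrite grid_time0 s0; exact: cvg_cst.
  apply: Jl => //.
    apply: filterS hw => m hw; rewrite grid_time_ge0/=.
    exact: (grid_time_lt (u := W^~ w)).
  apply: (@squeeze_cvgr _ _ _ _ (fun m => psum (W^~ w) k.+1 - n%:R / m.+1%:R)
    (fun=> psum (W^~ w) k.+1)).
  - by apply: filterS hw => m hw; exact: grid_time_near.
  - rewrite -[X in _ --> X]subr0; apply: cvgB; first exact: cvg_cst.
    by rewrite -(mulr0 n%:R); apply: cvgM; [exact: cvg_cst|exact: cvg_harmonic].
  - exact: cvg_cst.
have : g (increments (h m) w) @[m --> \oo] --> g (\sum_(k < n) c k * J k w).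
  apply: continuous_cvg; first exact: g_cont.
  rewrite /increments; apply: cvg_big => [|k _]; first exact: add_continuous.
  have -> : J k w = psum (J^~ w) k.+1 - psum (J^~ w) k by rewrite psumS addrAC subrr add0r.
  by apply: cvgM; [exact: cvg_cst|apply: cvgB; apply: sigma_cvg => //; exact: ltnW].
apply: cvg_trans; apply: near_eq_cvg; apply: filterS hw => m hw.
by rewrite (approxE (f := h m))//; exact/eventP.
Qed.

(** Independence has turned the integral of [approx m] into the finite mixture, and the bound [C]
    allows dominated convergence. *)
Lemma Rintegral_jumps_cvg :
  \sum_(f : index m) (\prod_(k < n) p (cell m (f k))) * \int[P]_w g (increments f w)
    @[m --> \oo] --> \int[P]_w g (\sum_(k < n) c k * J k w).
Proof.
under eq_cvg do rewrite -integral_approx.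
apply: (@Rintegral_cvg_bounded _ _ _ P approx _ C) => //.
apply: measurableT_comp; first exact: continuous_measurable_fun.
by apply: measurable_sum => k; apply: measurable_funM.
Qed.

End discretization.

(** * Recovering the waiting times from the counting process *)

Section trace_sigma_algebra.
Context {T : Type}.
Variables (F : set (set T)) (Z : set T).
Hypothesis F_sigma : sigma_algebra setT F.

(* The times [W k] are functions of [N] on an almost sure event [Z] only, so they
   are measurable for the trace on [Z] of the sigma-algebra of [N]. *)
Definition trace_algebra : set (set T) :=
  [set A | exists2 B, F B & forall w, Z w -> A w <-> B w].

Lemma sigma_algebra_trace : sigma_algebra setT trace_algebra.
Proof.
have [F0 FC FU] := F_sigma; split.
- by exists set0.
- move=> A [B FB AB]; exists (setT `\` B); first exact: FC.
  by move=> w /AB AB'; split=> -[_ nA]; split=> // /AB'.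
- move=> A HA.
  have /choice[B HB] n : exists B, F B /\ forall w, Z w -> A n w <-> B w.
    by have [B] := HA n; exists B.
  exists (\bigcup_k B k); first by apply: FU => n; case: (HB n).
  move=> w Zw; split=> -[k _ ABk]; exists k => //.
    by case: (HB k) => _ /(_ w Zw) <-.
  by case: (HB k) => _ /(_ w Zw) ->.
Qed.

End trace_sigma_algebra.

Lemma probability_full (R : realType) d (T : measurableType d) (P : probability T R)
    (A B Z : set T) : measurable A -> measurable B -> measurable Z ->
  P (~` Z) = 0%E -> (forall w, Z w -> A w <-> B w) -> P A = P B.
Proof.
move=> mA mB mZ Z0 AB.
have full C : measurable C -> P C = P (C `&` Z).
  move=> mC; rewrite (measureDI P mC mZ) -[RHS]add0e; congr (_ + _)%E.
  apply/eqP; rewrite eq_le measure_ge0 andbT -Z0.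
  by apply: le_measure; rewrite ?inE; [exact: measurableD|exact: measurableC|move=> w []].
rewrite full// [RHS]full//; congr (P _); apply/seteqP.
by split=> w [Aw Zw]; split => //; apply/AB.
Qed.

Section sigma_gen_theory.
Context d (T : measurableType d) d' (S : measurableType d').
Variables (I : Type) (D : set I) (X : I -> T -> S).

Lemma sigma_gen_sub (F : set (set T)) :
  sigma_algebra setT F ->
  (forall i B, D i -> measurable B -> F (X i @^-1` B)) -> sigma_gen D X `<=` F.
Proof.
move=> sF XF; apply: smallest_sub => // _ [i Di [B mB <-]].
by rewrite setTI; exact: XF.
Qed.

Lemma sigma_gen_measurable : (forall i, D i -> measurable_fun setT (X i)) ->
  sigma_gen D X `<=` measurable.
Proof.
move=> mX; apply: sigma_gen_sub; first exact: sigma_algebra_measurable.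
by move=> i B Di mB; rewrite -[X in measurable X]setTI; exact: mX.
Qed.

End sigma_gen_theory.

Section counting_process.
Context {R : realType} d (T : measurableType d) (P : probability T R).
Variables (N : R -> T -> nat) (W : nat -> T -> R).
Variables (F : set (set T)) (Z : set T).
Hypotheses (F_sigma : sigma_algebra setT F) (F_measurable : F `<=` measurable).
Hypotheses (mZ : measurable Z) (Z0 : P (~` Z) = 0%E).
Hypothesis N_F : forall t B, 0 <= t -> F (N t @^-1` B).
Hypothesis m_W : forall k, measurable_fun setT (W k).
Hypothesis W_gt0 : forall w, Z w -> forall k, 0 < W k w.
Hypothesis N_W : forall w, Z w -> forall (t : R) (n : nat), 0 <= t ->
  N t w = n <-> psum (W^~ w) n <= t < psum (W^~ w) n.+1.

Let TF := g_sigma_algebraType (trace_algebra F Z).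

(** Duality of jump times and counts: on [Z], for [x >= 0], the [n]-th jump time exceeds [x] exactly
    when [N x < n]. For [x < 0] it always does. *)
Let measurable_psum n : measurable_fun [set: TF] (fun w : TF => psum (W^~ w) n).
Proof.
apply: (measurability _ (RGenOInfty.measurableE R)) => _ [_ [x ->] <-].
rewrite setTI; apply: sub_sigma_algebra.
have psumW_lt w : Z w -> forall k, psum (W^~ w) k < psum (W^~ w) k.+1.
  by move=> Zw k; rewrite psumS ltrDl W_gt0.
have [x0|x0] := leP 0 x; last first.
  exists setT; first by have [F0 /(_ _ F0)] := F_sigma; rewrite setD0.
  move=> w Zw; split => // _; rewrite /= in_itv/= andbT (lt_le_trans x0)//.
  by rewrite -(psum0 (W^~ w)) psum_le//; exact: psumW_lt.
exists (N x @^-1` [set i | (i < n)%N]); first exact: N_F.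
move=> w Zw; rewrite /= in_itv/= andbT.
have /(N_W Zw)-/(_ x0)/andP[Nx xN] : N x w = N x w by [].
split=> [xn|Nn].
  rewrite ltnNge; apply/negP => /(psum_le (psumW_lt _ Zw)) nN.
  by have := lt_le_trans xn (le_trans nN Nx); rewrite ltxx.
by rewrite (lt_le_trans xN)// psum_le//; exact: psumW_lt.
Qed.

Lemma measurable_interarrival k : measurable_fun [set: TF] (W k).
Proof.
have -> : W k = (fun w => psum (W^~ w) k.+1 - psum (W^~ w) k).
  by apply/funext => w; rewrite psumS addrAC subrr add0r.
by apply: (@measurable_funB _ TF); exact: measurable_psum.
Qed.

(** On [Z] the event about the [W k] coincides with a member of [F]; as [Z] has full probability,
    the substitution changes no probability. *)
Lemma indep_interarrival (A : set T) : measurable A ->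
  (forall B, F B -> P (A `&` B) = (P A * P B)%E) ->
  forall n (B : nat -> set R), (forall k, measurable (B k)) ->
  P (A `&` \bigcap_(k < n) (W k @^-1` B k)) =
  (P A * P (\bigcap_(k < n) (W k @^-1` B k)))%E.
Proof.
move=> mA A_F n B mB; set E := \bigcap_(k < n) _.
have mE : measurable E.
  by apply: bigcap_measurableType => k _; rewrite -[X in measurable X]setTI; apply: m_W.
have : (trace_algebra F Z).-sigma.-measurable E.
  apply: (@bigcap_measurableType _ TF) => k _; rewrite -[X in measurable X]setTI.
  exact: measurable_interarrival.
rewrite measurable_g_measurableTypeE; last exact: sigma_algebra_trace.
move=> [E' FE' EE']; have mE' := F_measurable FE'.
rewrite (probability_full mE mE' mZ Z0 EE') -A_F//.
apply: (probability_full _ _ mZ Z0); [exact: measurableI|exact: measurableI|].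
by move=> w Zw; split=> -[Aw Ew]; split => //; apply/EE'.
Qed.

End counting_process.

(** * Averages over exponential waiting times *)

Section complex_exponential.
Context {R : realType}.
Implicit Types (x y : R[i]) (a b : R).

Lemma ReM x y : complex.Re (x * y) =
  complex.Re x * complex.Re y - complex.Im x * complex.Im y.
Proof. by case: x => a b; case: y => c e. Qed.

Lemma ImM x y : complex.Im (x * y) =
  complex.Re x * complex.Im y + complex.Im x * complex.Re y.
Proof. by case: x => a b; case: y => c e. Qed.

Lemma ReD x y : complex.Re (x + y) = complex.Re x + complex.Re y.
Proof. by case: x => a b; case: y => c e. Qed.

Lemma ImD x y : complex.Im (x + y) = complex.Im x + complex.Im y.
Proof. by case: x => a b; case: y => c e. Qed.

Lemma ReN x : complex.Re (- x) = - complex.Re x.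
Proof. by case: x. Qed.

Lemma ImN x : complex.Im (- x) = - complex.Im x.
Proof. by case: x. Qed.

Lemma Re_sum (I : Type) (r : seq I) (F : I -> R[i]) :
  complex.Re (\sum_(i <- r) F i) = \sum_(i <- r) complex.Re (F i).
Proof. exact: (big_morph _ ReD). Qed.

Lemma Im_sum (I : Type) (r : seq I) (F : I -> R[i]) :
  complex.Im (\sum_(i <- r) F i) = \sum_(i <- r) complex.Im (F i).
Proof. exact: (big_morph _ ImD). Qed.

Lemma Re_cexp x : complex.Re (cexp x) = expR (complex.Re x) * cos (complex.Im x).
Proof. by rewrite /cexp /cis ReM/= mul0r subr0. Qed.

Lemma Im_cexp x : complex.Im (cexp x) = expR (complex.Re x) * sin (complex.Im x).
Proof. by rewrite /cexp /cis ImM/= mul0r addr0. Qed.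

Lemma complex_ext x y : complex.Re x = complex.Re y -> complex.Im x = complex.Im y -> x = y.
Proof. by case: x => a b; case: y => c e /= -> ->. Qed.

Lemma cexpD x y : cexp (x + y) = cexp x * cexp y.
Proof.
apply: complex_ext.
  rewrite [RHS]ReM !Re_cexp !Im_cexp ReD ImD expRD cosD; ring.
rewrite [RHS]ImM Im_cexp !Re_cexp !Im_cexp ReD ImD expRD sinD; ring.
Qed.

Lemma cexp0 : cexp (0 : R[i]) = 1.
Proof. by apply: complex_ext; rewrite ?Re_cexp ?Im_cexp/= expR0 ?cos0 ?sin0 mul1r. Qed.

Lemma cexp_sum (I : Type) (r : seq I) (F : I -> R[i]) :
  cexp (\sum_(i <- r) F i) = \prod_(i <- r) cexp (F i).
Proof. exact: (big_morph _ cexpD cexp0). Qed.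

Lemma Re_prop (x : R[i]) a : complex.Re (a%:C * x) = a * complex.Re x.
Proof. by rewrite ReM/= mul0r subr0. Qed.

Lemma Im_prop (x : R[i]) a : complex.Im (a%:C * x) = a * complex.Im x.
Proof. by rewrite ImM/= mul0r addr0. Qed.

Lemma norm_Re_cexp x : complex.Re x <= 0 -> `|complex.Re (cexp x)| <= 1.
Proof.
move=> x0; rewrite Re_cexp normrM ger0_norm ?expR_ge0// mulr_ile1 ?expR_ge0//.
  by rewrite -expR0 ler_expR.
by rewrite ler_norml cos_geN1 cos_le1.
Qed.

Lemma norm_Im_cexp x : complex.Re x <= 0 -> `|complex.Im (cexp x)| <= 1.
Proof.
move=> x0; rewrite Im_cexp normrM ger0_norm ?expR_ge0// mulr_ile1 ?expR_ge0//.
  by rewrite -expR0 ler_expR.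
by rewrite ler_norml sin_geN1 sin_le1.
Qed.

(** Componentwise, because the integrals, Riemann sums and derivatives that enter are those of real
    functions. *)
Definition ccvg (u : nat -> R[i]) (l : R[i]) :=
  complex.Re (u m) @[m --> \oo] --> complex.Re l /\
  complex.Im (u m) @[m --> \oo] --> complex.Im l.

Lemma ccvg_cst l : ccvg (fun=> l) l.
Proof. by split; exact: cvg_cst. Qed.

Lemma ccvgB u v l k : ccvg u l -> ccvg v k -> ccvg (fun m => u m - v m) (l - k).
Proof.
move=> [ul ul'] [vk vk']; split; rewrite ?ReD ?ReN ?ImD ?ImN.
- by under eq_cvg do rewrite ReD ReN; exact: cvgB.
- by under eq_cvg do rewrite ImD ImN; exact: cvgB.
Qed.

Lemma ccvgM u v l k : ccvg u l -> ccvg v k -> ccvg (fun m => u m * v m) (l * k).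
Proof.
move=> [ul ul'] [vk vk']; split; rewrite ?ReM ?ImM.
- by under eq_cvg do rewrite ReM; apply: cvgB; exact: cvgM.
- by under eq_cvg do rewrite ImM; apply: cvgD; exact: cvgM.
Qed.

Lemma ccvg_prod (I : Type) (r : seq I) (u : I -> nat -> R[i]) (l : I -> R[i]) :
  (forall i, ccvg (u i) (l i)) ->
  ccvg (fun m => \prod_(i <- r) u i m) (\prod_(i <- r) l i).
Proof.
move=> ul; elim: r => [|i r ih].
  by rewrite big_nil (_ : (fun _ => _) = fun=> 1);
    [exact: ccvg_cst|apply/funext => m; rewrite big_nil].
rewrite big_cons (_ : (fun _ => _) = fun m => u i m * \prod_(j <- r) u j m).
  exact: ccvgM.
by apply/funext => m; rewrite big_cons.
Qed.

Lemma ccvg_unique u l k : ccvg u l -> ccvg u k -> l = k.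
Proof.
move=> [ul ul'] [uk uk'].
by apply: complex_ext; [exact: cvg_unique uk|exact: cvg_unique uk'].
Qed.

End complex_exponential.

(** * Riemann sums against the exponential law *)

Section exponential_law.
Context {R : realType}.
Variable rate : R.
Hypothesis rate_gt0 : 0 < rate.

Definition exponential_mass (B : set R) : R := fine (exponential_prob rate B).

Let mu := @lebesgue_measure R.

Let pdf_ge0 (x : R) : 0 <= exponential_pdf rate x.
Proof. exact/exponential_pdf_ge0/ltW. Qed.

Let integrable_pdf (B : set R) : measurable B ->
  mu.-integrable B (EFin \o exponential_pdf rate).
Proof.
by move=> mB; apply: integrableS (integrable_exponential_pdf rate_gt0).
Qed.

Lemma exponential_massE (B : set R) : measurable B ->
  exponential_prob rate B = (exponential_mass B)%:E.
Proof.
move=> mB; rewrite /exponential_mass fineK//.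
have mB' : measurable (B : set (measurableTypeR R)) by exact: mB.
exact: (integrable_fin_num mB' (integrable_pdf mB)).
Qed.

Lemma exponential_mass_cell m i :
  exponential_mass (cell m i) = expR (- rate * grid m i) - expR (- rate * grid m i.+1).
Proof.
have itvE (x : R) : 0 < x -> exponential_prob rate `[0, x] = (1 - expR (- rate * x))%:E.
  by move=> x0; rewrite exponential_prob_itv0c.
have gii : grid m i < grid m i.+1 :> R by rewrite gridS ltrDl invr_gt0.
have cellU : `[0, grid m i.+1 : R]%classic = `[0, grid m i] `|` cell m i.
  rewrite /cell -itv_bndbnd_setU// bnd_simp; [exact/ltW/grid_gt0|exact/ltW].
have cell0 : `[0, grid m i : R]%classic `&` cell m i = set0.
  apply/seteqP; split => // x [/=]; rewrite !in_itv/= => /andP[_ xi] /andP[ix _].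
  by have := lt_le_trans ix xi; rewrite ltxx.
pose I (x : R) : set R := `[0, x]%classic.
have : exponential_prob rate (I (grid m i.+1)) =
       (exponential_prob rate (I (grid m i)) + exponential_prob rate (cell m i))%E.
  rewrite /exponential_prob /I cellU ge0_integral_setU//=.
  - exact: measurable_itv.
  - by apply/measurable_EFinP; apply: measurable_funTS; exact: measurable_exponential_pdf.
  - by move=> x _; rewrite lee_fin.
  - exact/disj_set2P.
rewrite (exponential_massE (measurable_cell m i)).
rewrite /I !itvE ?grid_gt0// -EFinD => -[] e.
by rewrite -[LHS](addKr (1 - expR (- rate * grid m i))) -e; ring.
Qed.

Section riemann.
Variables (h : R -> R) (C : R).
Hypotheses (m_h : measurable_fun setT h) (h_bounded : forall x, 0 < x -> `|h x| <= C).
Hypothesis h_cont : forall x, 0 < x -> {for x, continuous h}.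

Let step m (x : R) : R := \sum_(i < (ncell m).+1) \1_(cell m i) x * h (grid m i).

Let stepE m (i : 'I_(ncell m).+1) x : cell m i x -> step m x = h (grid m i).
Proof.
move=> ix; apply: (sum_indic_disjoint (A := fun i : 'I_(ncell m).+1 => cell m i)
  (fun i : 'I_(ncell m).+1 => h (grid m i))) => // j jx.
by apply/val_inj; exact: cell_uniq jx ix.
Qed.

Let step_bounded m x : 0 < x -> `|step m x| <= C.
Proof.
move=> x0.
have [[i ix]|] := pselect (exists i : 'I_(ncell m).+1, cell m i x).
  by rewrite (stepE ix) h_bounded// grid_gt0.
move=> /forallNP nx; rewrite /step big1 ?normr0 ?(le_trans _ (h_bounded ltr01))// => i _.
by rewrite indicE memNset ?mul0r.
Qed.

Let measurable_step m : measurable_fun setT (step m).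
Proof.
apply: measurable_sum => i; apply: measurable_funM => //.
by apply: measurable_indic; exact: measurable_cell.
Qed.

Let step_cvg x : 0 < x -> step ^~ x @ \oo --> h x.
Proof.
move=> x0; have hx := near_cell_index x0.
have gx : grid m (cell_index m x) @[m --> \oo] --> x.
  apply: (@squeeze_cvgr _ _ _ _ (fun m => x - m.+1%:R^-1) (fun=> x)).
  - apply: filterS hx => m; rewrite /cell/= in_itv/= gridS => /andP[gx xg].
    by rewrite lerBlDr xg ltW.
  - rewrite -[X in _ --> X]subr0; apply: cvgB; first exact: cvg_cst.
    exact: cvg_harmonic.
  - exact: cvg_cst.
have : h (grid m (cell_index m x)) @[m --> \oo] --> h x.
  by apply: continuous_cvg => //; exact: h_cont.
apply: cvg_trans; apply: near_eq_cvg; apply: filterS hx => m hx.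
by rewrite (stepE hx).
Qed.

(** The sum is the integral of a step function against the density, and [C] times the density
    dominates. The conditions on [h] concern positive reals, where the grid points lie and where the
    powers used in (2) are continuous. *)
Lemma exponential_riemann :
  \sum_(i < (ncell m).+1) exponential_mass (cell m i) * h (grid m i) @[m --> \oo]
  --> \int[lebesgue_measure]_(x in `[0, +oo[) (h x * (rate * expR (- (rate * x)))).
Proof.
pose D : set R := `]0, +oo[%classic.
have pos (x : R) : D x -> 0 < x by rewrite /D/= in_itv/= andbT.
have m0y : measurable (D : set (measurableTypeR R)) by exact: measurable_itv.
have mpdf : measurable_fun setT (exponential_pdf rate) by exact: measurable_exponential_pdf.
have hpdfE (x : R) : D x -> h x * (rate * expR (- (rate * x))) = h x * exponential_pdf rate x.
  by move=> /pos x0; rewrite exponential_pdfE ?mulNr// ltW.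
have m_hpdf : measurable_fun D (fun x : R => h x * exponential_pdf rate x).
  by apply: measurable_funTS; exact: measurable_funM.
have [] := @dominated_convergence _ _ _ mu D m0y
  (fun m x => (step m x * exponential_pdf rate x)%:E)
  (fun x => (h x * exponential_pdf rate x)%:E)
  (fun x => (C * exponential_pdf rate x)%:E).
- move=> m; apply/measurable_EFinP; apply: measurable_funTS.
  by apply: (@measurable_funM _ R); [exact: measurable_step|exact: mpdf].
- exact/measurable_EFinP.
- apply: aeW => x /pos x0; apply: cvg_EFin; first exact: nearW.
  by apply: cvgM; [exact: step_cvg|exact: cvg_cst].
- under eq_fun do rewrite EFinM.
  by apply: integrableZl => //; exact: integrable_pdf.
- apply: aeW => x m /pos x0; rewrite lee_fin normrM [X in _ * X]ger0_norm//.
  by rewrite ler_wpM2r// step_bounded.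
move=> ih _; rewrite -(fineK (integrable_fin_num m0y ih)) => /fine_cvg.
have -> : fine (\int[mu]_(x in D) (h x * exponential_pdf rate x)%:E) =
    \int[lebesgue_measure]_(x in `[0, +oo[) (h x * (rate * expR (- (rate * x)))).
  rewrite -Rintegral_itv_obnd_cbnd; last first.
    apply: eq_integrable ih; first exact: measurable_itv.
    by move=> x /set_mem x0; rewrite /= hpdfE.
  by apply: eq_Rintegral => x /set_mem x0; rewrite hpdfE.
apply: cvg_trans; apply: near_eq_cvg; apply: nearW => m.
rewrite -[LHS]/(\int[mu]_(x in D) (step m x * exponential_pdf rate x)).
pose F i (x : R) : R := h (grid m i) * (exponential_pdf rate \_ (cell m i)) x.
have mcell i : measurable (cell m i : set (measurableTypeR R)) by exact: measurable_itv.
have i_pdf i : mu.-integrable D (EFin \o (exponential_pdf rate \_ (cell m i))).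
  apply: (@integrableS _ _ _ mu setT) => //.
  rewrite -restrict_EFin.
  exact: (@integrable_mkcond _ _ _ mu _ _ (mcell i)).1 (integrable_pdf (mcell i)).
transitivity (\int[mu]_(x in D) (\sum_(i < (ncell m).+1) F i x)).
  apply: eq_Rintegral => x _; rewrite mulr_suml; apply: eq_bigr => i _.
  rewrite /F patchE indicE; case: ifP => _; first by rewrite mul1r.
  by rewrite !mul0r mulr0.
rewrite Rintegral_sum//; last first.
  by move=> i; exact: (@integrableZl _ _ _ mu D m0y (h (grid m i)) _ (i_pdf i)).
apply: eq_bigr => i _; rewrite RintegralZl// mulrC; congr (_ * _).
rewrite -Rintegral_mkcondr setIidr// => x; rewrite /cell /D/= !in_itv/= andbT.
by move=> /andP[ix _]; rewrite (lt_trans _ ix)// grid_gt0.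
Qed.
End riemann.
End exponential_law.

(** * Laplace transform of the exponential law at a complex argument *)

Section laplace.
Context {R : realType}.

Lemma cvg_is_derive0 (phi : R -> R) (l : R) : is_derive (0 : R) 1 phi l ->
  m.+1%:R * (phi m.+1%:R^-1 - phi 0) @[m --> \oo] --> l.
Proof.
move=> [dphi <-].
have h0 : harmonic @ \oo --> (0 : R)^'.
  move=> A [e e0 HA]; have := @cvg_harmonic R.
  move=> /cvgrPdist_lt/(_ e e0); apply: filterS => m me.
  by apply: HA => //; rewrite /harmonic /= invr_neq0.
have := cvg_comp _ _ h0 dphi; apply: cvg_trans; apply: near_eq_cvg.
by apply: nearW => m /=; rewrite invrK addr0 /GRing.scale/= mulr1.
Qed.

(** This is the derivative at [0] of [1 - cexp (- (a * t))], read along [t = 1 / (m + 1)]. *)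
Lemma ccvg_cexp_diff (a : R[i]) :
  ccvg (fun m => (m.+1%:R)%:C * (1 - cexp (- (a * (m.+1%:R^-1)%:C)))) a.
Proof.
have ReE t : complex.Re (- (a * t%:C)) = - complex.Re a * t.
  by rewrite ReN ReM/= mulr0 subr0 mulNr.
have ImE t : complex.Im (- (a * t%:C)) = - complex.Im a * t.
  by rewrite ImN ImM/= mulr0 add0r mulNr.
split.
  pose phi (t : R) : R := - (expR (- complex.Re a * t) * cos (- complex.Im a * t)).
  have dphi : is_derive (0 : R) 1 phi (complex.Re a).
    apply: is_derive_eq; rewrite /GRing.scale/= !mulr0 expR0 cos0 sin0; ring.
  have := cvg_is_derive0 dphi; apply: cvg_trans; apply: near_eq_cvg; apply: nearW => m.
  rewrite Re_prop ReD ReN Re_cexp ReE ImE /phi !mulr0 expR0 cos0/=; ring.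
pose phi (t : R) : R := - (expR (- complex.Re a * t) * sin (- complex.Im a * t)).
have dphi : is_derive (0 : R) 1 phi (complex.Im a).
  apply: is_derive_eq; rewrite /GRing.scale/= !mulr0 expR0 cos0 sin0; ring.
have := cvg_is_derive0 dphi; apply: cvg_trans; apply: near_eq_cvg; apply: nearW => m.
rewrite Im_prop ImD ImN Im_cexp ReE ImE /phi !mulr0 expR0 sin0/=; ring.
Qed.


Section laplace_transform.
Variable rate : R.
Hypothesis rate_gt0 : 0 < rate.
Variable c : R[i].
Hypothesis Re_c_ge0 : 0 <= complex.Re c.

Let E (x : R) : R[i] := cexp (- ((rate%:C + c) * x%:C)).

Let step_factor (m : nat) : R[i] := 1 - cexp (- (rate%:C * (m.+1%:R^-1)%:C)).

Lemma cexp_real (x : R) : cexp x%:C = (expR x)%:C.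
Proof. by apply: complex_ext; rewrite ?Re_cexp ?Im_cexp/= ?cos0 ?sin0 ?mulr1 ?mulr0. Qed.

Let E_S m i : E (grid m i.+1) = E (grid m i) * E (m.+1%:R^-1).
Proof. by rewrite /E -cexpD gridS rmorphD/= mulrDr opprD. Qed.

Let massE m i : (exponential_mass rate (cell m i))%:C * cexp (- (c * (grid m i)%:C)) =
  step_factor m * E (grid m i).
Proof.
have EE x : E x = cexp (- (rate%:C * x%:C)) * cexp (- (c * x%:C)).
  by rewrite -cexpD -opprD -mulrDl.
have rE t : cexp (- (rate%:C * t%:C)) = (expR (- rate * t))%:C.
  by rewrite -rmorphM -rmorphN cexp_real mulNr.
rewrite EE mulrA exponential_mass_cell// /step_factor !rE; congr (_ * _).
by rewrite gridS mulrDr expRD rmorphB rmorphM/=; ring.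
Qed.

(* A geometric series, multiplied by [1 - E m.+1%:R^-1] so as to avoid limits of
   quotients in [R[i]]. *)
Let sumE m : (\sum_(i < (ncell m).+1)
    (exponential_mass rate (cell m i))%:C * cexp (- (c * (grid m i)%:C))) *
    ((m.+1%:R)%:C * (1 - E (m.+1%:R^-1))) =
  ((m.+1%:R)%:C * step_factor m) * (E (grid m 0) - E (grid m (ncell m).+1)).
Proof.
rewrite (eq_bigr (fun i : 'I_(ncell m).+1 => step_factor m * E (grid m i))); last first.
  by move=> i _; rewrite massE.
rewrite -mulr_sumr.
have -> : E (grid m 0) - E (grid m (ncell m).+1) =
    (\sum_(i < (ncell m).+1) E (grid m i)) * (1 - E (m.+1%:R^-1)).
  rewrite mulr_suml -opprB -(telescope_sumr (fun i => E (grid m i)) (leq0n _)) big_mkord.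
  rewrite -sumrN; apply: eq_bigr => i _; rewrite E_S; ring.
ring.
Qed.

Let E_first : ccvg (fun m => E (grid m 0)) 1.
Proof.
have d0 : ccvg (fun m => (m.+1%:R^-1 : R)%:C) 0.
  by split => /=; [exact: cvg_harmonic|exact: cvg_cst].
(* Continuity at [0] is drawn from the derivative: [E x] is [1 - x * (x^-1 * (1 - E x))] at
   [x = 1 / (m + 1)]. *)
have := ccvgB (ccvg_cst 1) (ccvgM d0 (ccvg_cexp_diff (rate%:C + c))).
rewrite mul0r subr0; congr (ccvg _ _); apply/funext => m.
rewrite mulrA -rmorphM/= mulVf// mul1r subKr.
by rewrite /E /grid mul1r.
Qed.

Let E_last : ccvg (fun m => E (grid m (ncell m).+1)) 0.
Proof.
have ReE m : complex.Re (- ((rate%:C + c) * (grid m (ncell m).+1)%:C)) <=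
    - rate * grid m (ncell m).+1.
  rewrite ReN ReM ReD/= mulr0 subr0 -mulNr ler_wpM2r//; first exact/ltW/grid_gt0.
  by rewrite opprD gerDl oppr_le0.
(* From [expR y >= 1 + y >= y] at [y = rate * grid m (ncell m).+1], which is at least
   [rate * (m + 1)]. *)
have bound m : expR (- rate * grid m (ncell m).+1) <= rate^-1 * m.+1%:R^-1.
  rewrite mulNr expRN -invfM lef_pV2 ?posrE ?expR_gt0 ?mulr_gt0//.
  rewrite (@le_trans _ _ (rate * grid m (ncell m).+1))//.
    rewrite ler_pM2l// /grid ler_pdivlMr// -natrM ler_nat.
    by rewrite -addn2 leq_addr.
  by rewrite (le_trans _ (expR_ge1Dx _))// lerDr.
have lim0 : rate^-1 * m.+1%:R^-1 @[m --> \oo] --> (0 : R).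
  by rewrite -(mulr0 rate^-1); apply: cvgM; [exact: cvg_cst|exact: cvg_harmonic].
have lim0' : - (rate^-1 * m.+1%:R^-1) @[m --> \oo] --> (0 : R).
  by rewrite -oppr0; exact: cvgN.
have small x m : complex.Re x <= - rate * grid m (ncell m).+1 -> forall u, `|u| <= 1 ->
    - (rate^-1 * m.+1%:R^-1) <= expR (complex.Re x) * u <= rate^-1 * m.+1%:R^-1.
  move=> xm u u1; rewrite -ler_norml normrM ger0_norm ?expR_ge0//.
  rewrite (@le_trans _ _ (expR (complex.Re x)))// ?ler_piMr ?expR_ge0//.
  by rewrite (le_trans _ (bound m))// ler_expR.
split.
  apply: (squeeze_cvgr _ lim0' lim0); apply: nearW => m.
  by rewrite Re_cexp small// ler_norml cos_geN1 cos_le1.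
apply: (squeeze_cvgr _ lim0' lim0); apply: nearW => m.
by rewrite Im_cexp small// ler_norml sin_geN1 sin_le1.
Qed.

(** Riemann sums provide some limit [l]; the limit of the identity [sumE] then reads
    [l * (rate + c) = rate], so no complex integral is computed. The sign of the real part of [c]
    bounds the integrand and keeps [rate + c] away from zero. *)
Lemma exponential_laplace :
  ccvg (fun m => \sum_(i < (ncell m).+1)
    (exponential_mass rate (cell m i))%:C * cexp (- (c * (grid m i)%:C)))
  (rate%:C / (rate%:C + c)).
Proof.
set S := fun m => _.
have Re_le0 (x : R) : 0 < x -> complex.Re (- (c * x%:C)) <= 0.
  by move=> x0; rewrite ReN ReM/= mulr0 subr0 oppr_le0 mulr_ge0// ltW.
have Re_lin (x : R) : complex.Re (- (c * x%:C)) = - complex.Re c * x.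
  by rewrite ReN ReM/= mulr0 subr0 mulNr.
have Im_lin (x : R) : complex.Im (- (c * x%:C)) = - complex.Im c * x.
  by rewrite ImN ImM/= mulr0 add0r mulNr.
have cont_lin (a : R) : continuous (fun x : R => a * x).
  by move=> x; apply: cvgM; [exact: cvg_cst|exact: cvg_id].
have cont_exp (a : R) : continuous (fun x : R => expR (a * x)).
  by move=> x; apply: continuous_comp; [exact: cont_lin|exact: continuous_expR].
pose hR (x : R) : R := complex.Re (cexp (- (c * x%:C))).
pose hI (x : R) : R := complex.Im (cexp (- (c * x%:C))).
have cR : continuous hR.
  rewrite (_ : hR = fun x => expR (- complex.Re c * x) * cos (- complex.Im c * x)).
    move=> x; apply: cvgM; first exact: cont_exp.
    by apply: continuous_comp; [exact: cont_lin|exact: continuous_cos].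
  by apply/funext => x; rewrite /hR Re_cexp Re_lin Im_lin.
have cI : continuous hI.
  rewrite (_ : hI = fun x => expR (- complex.Re c * x) * sin (- complex.Im c * x)).
    move=> x; apply: cvgM; first exact: cont_exp.
    by apply: continuous_comp; [exact: cont_lin|exact: continuous_sin].
  by apply/funext => x; rewrite /hI Im_cexp Re_lin Im_lin.
have [l Sl] : exists l, ccvg S l.
  have limR := @exponential_riemann _ rate rate_gt0 hR 1 (continuous_measurable_fun cR)
    (fun x x0 => norm_Re_cexp (Re_le0 x x0)) (fun x _ => cR x).
  have limI := @exponential_riemann _ rate rate_gt0 hI 1 (continuous_measurable_fun cI)
    (fun x x0 => norm_Im_cexp (Re_le0 x x0)) (fun x _ => cI x).
  exists (Complex (\int[lebesgue_measure]_(x in `[0, +oo[) (hR x * (rate * expR (- (rate * x)))))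
     (\int[lebesgue_measure]_(x in `[0, +oo[) (hI x * (rate * expR (- (rate * x)))))).
  split => /=.
    move: limR; apply: cvg_trans; apply: near_eq_cvg; apply: nearW => m.
    by rewrite /S Re_sum; apply: eq_bigr => i _; rewrite Re_prop.
  move: limI; apply: cvg_trans; apply: near_eq_cvg; apply: nearW => m.
  by rewrite /S Im_sum; apply: eq_bigr => i _; rewrite Im_prop.
have rc0 : rate%:C + c != 0.
  rewrite eq_complex negb_and; apply/orP; left.
  by rewrite ReD/= gt_eqF// ltr_wpDr.
have lim1 := ccvgM Sl (ccvg_cexp_diff (rate%:C + c)).
have lim2 := ccvgM (ccvg_cexp_diff (rate%:C)) (ccvgB E_first E_last).
rewrite subr0 mulr1 in lim2.
have e : l * (rate%:C + c) = rate%:C.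
  by apply: (ccvg_unique lim1); move: lim2; congr (ccvg _ _); apply/funext => m; rewrite -sumE.
by have -> : rate%:C / (rate%:C + c) = l by rewrite -[X in X / _]e mulfK.
Qed.

End laplace_transform.

End laplace.

(** * Spectral measures *)

Section charge_combination.
Context {R : realType} d (T : measurableType d).

Lemma charge_decomp (nu : {charge set T -> \bar R}) (A : set T) : measurable A ->
  nu A = (charge_pos nu A - charge_neg nu A)%E.
Proof.
move=> mA; rewrite [LHS](jordan_decomp (projT2 (cid (projT2 (cid (Hahn_decomposition nu)))))  mA).
by rewrite /cadd /= cscaleN1.
Qed.

Variables (n : nat) (Gamma : {finite_measure set T -> \bar R}).
Variables (nu : 'I_n -> {charge set T -> \bar R}) (t : 'I_n -> R).
Hypothesis t_ge0 : forall j, 0 <= t j.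
Hypothesis GammaE : forall A, measurable A ->
  Gamma A = (\sum_(j < n) (t j)%:E * nu j A)%E.

(** Indexed by natural numbers, with the zero measure from [n] on, to fit [msum]. *)
Let scaled (m : 'I_n -> {measure set T -> \bar R}) (k : nat) : {measure set T -> \bar R} :=
  if insub k is Some j then mscale (NngNum (t_ge0 j)) (m j) else mzero.

Let pos (j : 'I_n) : {measure set T -> \bar R} := charge_pos (nu j).
Let neg (j : 'I_n) : {measure set T -> \bar R} := charge_neg (nu j).

Let scaledE m (j : 'I_n) A : scaled m j A = ((t j)%:E * m j A)%E.
Proof. by rewrite /scaled valK. Qed.

Let fin_pos j A : measurable A -> pos j A \is a fin_num.
Proof. by move=> mA; rewrite /pos /charge_pos; exact: fin_num_measure. Qed.

Let fin_neg j A : measurable A -> neg j A \is a fin_num.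
Proof. by move=> mA; rewrite /neg /charge_neg; exact: fin_num_measure. Qed.

(* Moving the negative parts to the left gives an equality of measures. *)
Let measureE A : measurable A ->
  measure_add Gamma (msum (scaled neg) n) A = msum (scaled pos) n A.
Proof.
move=> mA; transitivity (Gamma A + msum (scaled neg) n A)%E; first exact: measure_addE.
rewrite GammaE// /msum -big_split/=; apply: eq_bigr => j _.
have -> : nu j A = (pos j A - neg j A)%E by exact: charge_decomp.
rewrite !scaledE.
rewrite -(fineK (fin_pos j mA)) -(fineK (fin_neg j mA)).
transitivity ((t j * (fine (pos j A) - fine (neg j A)) + t j * fine (neg j A))%:E) => //.
by rewrite -mulrDr subrK EFinM.
Qed.

Let ge0_integral_combination (D : set T) (f : T -> \bar R) : measurable D ->
  measurable_fun D f -> (forall x, D x -> 0 <= f x)%E ->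
  (\int[Gamma]_(x in D) f x + \sum_(j < n) (t j)%:E * \int[neg j]_(x in D) f x =
   \sum_(j < n) (t j)%:E * \int[pos j]_(x in D) f x)%E.
Proof.
move=> mD mf f0.
have scaled_int m : (\int[msum (scaled m) n]_(x in D) f x =
    \sum_(j < n) (t j)%:E * \int[m j]_(x in D) f x)%E.
  rewrite ge0_integral_measure_sum//; apply: eq_bigr => j _.
  by rewrite /scaled valK ge0_integral_mscale.
rewrite -!scaled_int -ge0_integral_measure_add//.
by apply: eq_measure_integral => A mA _; exact: measureE.
Qed.

(** The equality of measures yields equal integrals for nonnegative functions. As a real quantity,
    additive in [f], the gap can be followed to functions of any sign. *)
Let discrepancy (D : set T) (f : T -> R) : R := \int[Gamma]_(x in D) f x +
  \sum_(j < n) t j * \int[neg j]_(x in D) f x - \sum_(j < n) t j * \int[pos j]_(x in D) f x.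

Let fin_Gamma A : measurable A -> Gamma A \is a fin_num.
Proof. by move=> mA; exact: fin_num_measure. Qed.

Let discrepancy_ge0 (D : set T) (f : T -> R) (C : R) : measurable D ->
  measurable_fun D f -> (forall x, D x -> `|f x| <= C) -> (forall x, D x -> 0 <= f x) ->
  discrepancy D f = 0.
Proof.
move=> mD mf fC f0.
have int_fin (m : {measure set T -> \bar R}) : (forall A, measurable A -> m A \is a fin_num) ->
    (\int[m]_(x in D) (f x)%:E)%E = (\int[m]_(x in D) f x)%:E.
  move=> mfin; rewrite fineK//; apply: integrable_fin_num => //.
  exact: integrable_bounded (mfin D mD) mD mf fC.
have := @ge0_integral_combination D (EFin \o f) mD.
move=> /(_ (proj2 (measurable_EFinP _ _) mf) f0).
rewrite (int_fin _ fin_Gamma).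
under eq_bigr do rewrite (int_fin _ (fin_neg _)) -EFinM.
under [RHS]eq_bigr do rewrite (int_fin _ (fin_pos _)) -EFinM.
by rewrite !sumEFin -EFinD => -[e]; rewrite /discrepancy e subrr.
Qed.

Let discrepancyD (D : set T) (f g : T -> R) (C : R) : measurable D ->
  measurable_fun D f -> (forall x, D x -> `|f x| <= C) ->
  measurable_fun D g -> (forall x, D x -> `|g x| <= C) ->
  discrepancy D (fun x => f x + g x) = discrepancy D f + discrepancy D g.
Proof.
move=> mD mf fC mg gC.
have add (m : {measure set T -> \bar R}) : (forall A, measurable A -> m A \is a fin_num) ->
    \int[m]_(x in D) (f x + g x) = \int[m]_(x in D) f x + \int[m]_(x in D) g x.
  move=> mfin; rewrite RintegralD//; first exact: integrable_bounded (mfin D mD) mD mf fC.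
  exact: integrable_bounded (mfin D mD) mD mg gC.
rewrite /discrepancy (add _ fin_Gamma).
under eq_bigr do rewrite (add _ (fin_neg _)) mulrDr.
under [X in _ - X]eq_bigr do rewrite (add _ (fin_pos _)) mulrDr.
by rewrite !big_split/=; ring.
Qed.

Lemma Rintegral_combination (D : set T) (f : T -> R) (C : R) : measurable D ->
  measurable_fun D f -> (forall x, D x -> `|f x| <= C) ->
  \int[Gamma]_(x in D) f x = \sum_(j < n) t j *
    (\int[charge_pos (nu j)]_(x in D) f x - \int[charge_neg (nu j)]_(x in D) f x).
Proof.
move=> mD mf fC.
(* [f] is the difference of the nonnegative functions [f + |C|] and [|C|]. The absolute value covers
   an empty [D], for which [C] may be negative. *)
have mC : measurable_fun D (fun=> `|C| : R) by exact: measurable_cst.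
have fC' x : D x -> `|f x| <= `|C| by move=> /fC; move/le_trans; apply; exact: ler_norm.
have CC x : D x -> `| `|C| | <= `|C| by rewrite normr_id.
have fC0 x : D x -> 0 <= f x + `|C|.
  by move=> /fC'; rewrite ler_norml => /andP[]; rewrite -subr_ge0 opprK.
have fC2 x : D x -> `|f x + `|C| | <= `|C| + `|C|.
  by move=> Dx; rewrite (le_trans (ler_normD _ _))// lerD ?fC'// normr_id.
have := discrepancyD mD mf fC' mC CC.
rewrite (discrepancy_ge0 mD (measurable_funD mf mC) fC2 fC0).
rewrite (discrepancy_ge0 mD mC CC) ?addr0// => /esym.
rewrite /discrepancy => /eqP; rewrite -addrA addr_eq0 => /eqP ->.
rewrite opprB -sumrB; apply: eq_bigr => j _.
by rewrite mulrBr.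
Qed.

End charge_combination.

(** * The kernel [(-i x)^alpha] *)

Section stable_kernel_theory.
Context {R : realType}.
Variable alpha : R.
Hypotheses (alpha_gt0 : 0 < alpha) (alpha_lt1 : alpha < 1).

Definition kernel_Re (x : R) : R := `|x| `^ alpha * cos (alpha * (pi / 2)).

(* The difference of powers is [- sgr x * `|x| `^ alpha]. *)
Definition kernel_Im (x : R) : R :=
  (Num.max (- x) 0 `^ alpha - Num.max x 0 `^ alpha) * sin (alpha * (pi / 2)).

(** The principal argument of [-i x] is [- sgr x * (pi / 2)] for nonzero [x]; the cosine ignores its
    sign, the sine does not. At [0] the default argument [pi / 2] is harmless since the modulus
    vanishes. *)
Lemma cpowNi (x : R) :
  cpow (- 'i%C * x%:C) alpha = Complex (kernel_Re x) (kernel_Im x).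
Proof.
have -> : - 'i%C * x%:C = Complex 0 (- x).
  by apply: complex_ext; rewrite ?ReM ?ImM ?ReN ?ImN/=; ring.
have a0 : alpha != 0 by rewrite gt_eqF.
rewrite /cpow /cmod /carg /= expr0n add0r sqrrN sqrtr_sqr mul0r acos0 /cis.
rewrite /kernel_Re /kernel_Im; apply: complex_ext; rewrite ?Re_prop ?Im_prop /=.
  by case: ifP => // _; rewrite mulrN cosN.
have [x0|x0|->] := ltgtP x 0.
- by rewrite oppr_ge0 (ltW x0) ltr0_norm// powR0// subr0 max_l ?oppr_ge0 ?ltW.
- rewrite oppr_ge0 leNgt x0/= gtr0_norm// mulrN sinN max_r ?oppr_le0 ?ltW//.
  by rewrite powR0// sub0r mulNr mulrN.
- by rewrite oppr0 normr0 powR0// maxxx powR0// subrr !mul0r.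
Qed.

(** As [0 < alpha < 1], the angle [alpha * (pi / 2)] lies where the cosine is nonnegative. *)
Lemma kernel_Re_ge0 (x : R) : 0 <= kernel_Re x.
Proof.
rewrite /kernel_Re mulr_ge0 ?powR_ge0// cos_ge0_pihalf//.
have p0 : 0 < pi / 2 :> R by rewrite divr_gt0 ?pi_gt0.
have ap0 := mulr_gt0 alpha_gt0 p0.
apply/andP; split; last by rewrite ger_pMl// ltW.
by apply: (@le_trans _ _ 0); [rewrite oppr_le0 ltW|rewrite ltW].
Qed.

Lemma measurable_kernel_Re : measurable_fun setT kernel_Re.
Proof.
apply: measurable_funM => //.
exact: (measurableT_comp (measurable_powR alpha) (@normr_measurable R setT)).
Qed.

Lemma measurable_kernel_Im : measurable_fun setT kernel_Im.
Proof.
have mN : measurable_fun [set: R] (fun x : R => Num.max (- x) 0).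
  by apply: measurable_maxr => //; exact: measurable_funN.
have mP : measurable_fun [set: R] (fun x : R => Num.max x 0) by exact: measurable_maxr.
apply: measurable_funM => //; apply: measurable_funB.
  exact: (measurableT_comp (measurable_powR alpha) mN).
exact: (measurableT_comp (measurable_powR alpha) mP).
Qed.

Lemma norm_kernel_Re (x B : R) : `|x| <= B -> `|kernel_Re x| <= B `^ alpha.
Proof.
move=> xB; have B0 : 0 <= B by rewrite (le_trans _ xB).
rewrite /kernel_Re normrM ger0_norm ?powR_ge0//.
rewrite (@le_trans _ _ (`|x| `^ alpha))//.
  by rewrite ler_piMr ?powR_ge0// ler_norml cos_geN1 cos_le1.
by rewrite ge0_ler_powR ?nnegrE// ltW.
Qed.

Lemma norm_kernel_Im (x B : R) : `|x| <= B -> `|kernel_Im x| <= B `^ alpha.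
Proof.
move=> xB; have B0 : 0 <= B by rewrite (le_trans _ xB).
have a0 : alpha != 0 by rewrite gt_eqF.
rewrite /kernel_Im normrM.
rewrite (@le_trans _ _ `|Num.max (- x) 0 `^ alpha - Num.max x 0 `^ alpha|)//.
  by rewrite ler_piMr// ler_norml sin_geN1 sin_le1.
rewrite (@le_trans _ _ (`|x| `^ alpha))//; last by rewrite ge0_ler_powR ?nnegrE// ltW.
have [x0|x0|->] := ltgtP x 0.
- rewrite max_l ?oppr_ge0 ?(ltW x0)// powR0// subr0 (ltr0_norm x0).
  by rewrite ger0_norm ?powR_ge0.
- rewrite max_r ?oppr_le0 ?(ltW x0)// powR0// sub0r normrN (gtr0_norm x0).
  by rewrite ger0_norm ?powR_ge0.
- by rewrite oppr0 maxxx subrr normr0 powR_ge0.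
Qed.

Variable n : nat.
Implicit Types xi : 'cV[R]_n.

Definition pairing xi (s : n.-tuple R) : R := \sum_(i < n) xi i 0 * tnth s i.

Lemma stable_kernelE xi (s : n.-tuple R) :
  stable_kernel alpha xi s = Complex (kernel_Re (pairing xi s)) (kernel_Im (pairing xi s)).
Proof. exact: cpowNi. Qed.

Lemma measurable_pairing xi : measurable_fun setT (pairing xi).
Proof.
apply: measurable_sum => i; apply: measurable_funM => //; exact: measurable_tnth.
Qed.

Lemma measurable_Omega : measurable (Omega n : set (n.-tuple R)).
Proof.
have mt i : measurable_fun [set: n.-tuple R] (fun s => tnth s i) by exact: measurable_tnth.
have -> : Omega n = [set s : n.-tuple R | \sum_(i < n) tnth s i ^+ 2 = 1] `&`
    (\bigcap_(i in [set: 'I_n]) [set s | 0 <= tnth s i] `&`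
     \bigcap_(ij in [set ij : 'I_n * 'I_n | (ij.1 <= ij.2)%N])
       [set s : n.-tuple R | tnth s ij.1 <= tnth s ij.2]).
  apply/seteqP; split=> [s [s1 s0 sle]|s [s1 [s0 sle]]].
    by split => //; split=> [i _|[i j] /=]; [exact: s0|exact: sle].
  by split => // [i|i j ij]; [exact: s0|exact: (sle (i, j))].
apply: measurableI.
  have mf : measurable_fun [set: n.-tuple R] (fun s => \sum_(i < n) tnth s i ^+ 2).
    by apply: measurable_sum => i; exact: measurable_funX.
  by rewrite -[X in measurable X]setTI; exact: (mf measurableT [set 1]).
apply: measurableI.
  apply: fin_bigcap_measurable => // i _.
  rewrite (_ : [set _ | _] = (fun s => tnth s i) @^-1` `[0, +oo[); last first.
    by apply/seteqP; split=> s /=; rewrite in_itv/= andbT.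
  by rewrite -[X in measurable X]setTI; apply: mt.
apply: fin_bigcap_measurable => // -[i j] _ /=.
rewrite (_ : [set _ | _] = (fun s => tnth s j - tnth s i) @^-1` `[0, +oo[); last first.
  by apply/seteqP; split=> s /=; rewrite in_itv/= andbT subr_ge0.
by rewrite -[X in measurable X]setTI; apply: measurable_funB.
Qed.

Lemma pairing_bounded xi (s : n.-tuple R) : Omega n s ->
  `|pairing xi s| <= \sum_(i < n) `|xi i 0|.
Proof.
move=> [s1 _ _]; rewrite (le_trans (ler_norm_sum _ _ _))// ler_sum// => i _.
rewrite normrM ler_piMr// -(@ler_pXn2r _ 2)// ?nnegrE// real_normK ?num_real// expr1n.
by rewrite -s1 (bigD1 i)//= lerDl sumr_ge0// => j _; exact: sqr_ge0.
Qed.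

Lemma Re_cintegral_stable_kernel_ge0 (Gamma : {measure set (n.-tuple R) -> \bar R}) xi :
  0 <= complex.Re (cintegral Gamma (Omega n) (stable_kernel alpha xi)).
Proof. by apply: Rintegral_ge0 => s _; rewrite stable_kernelE kernel_Re_ge0. Qed.

Lemma cintegral_combination (Gamma : {finite_measure set (n.-tuple R) -> \bar R})
    (nu : 'I_n -> {charge set (n.-tuple R) -> \bar R}) (t : 'I_n -> R) xi :
  (forall j, 0 <= t j) ->
  (forall A, measurable A -> Gamma A = (\sum_(j < n) (t j)%:E * nu j A)%E) ->
  cintegral Gamma (Omega n) (stable_kernel alpha xi) =
  \sum_(j < n) (t j)%:C * charge_cintegral (nu j) (Omega n) (stable_kernel alpha xi).
Proof.
move=> t0 GammaE; set B := \sum_(i < n) `|xi i 0|.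
have KE : stable_kernel alpha xi =
    fun s => Complex (kernel_Re (pairing xi s)) (kernel_Im (pairing xi s)).
  by apply/funext => s; exact: stable_kernelE.
rewrite KE; apply: complex_ext; rewrite ?Re_sum ?Im_sum.
  under [RHS]eq_bigr do rewrite Re_prop ReD ReN.
  apply: (@Rintegral_combination _ _ _ _ _ _ _ t0 GammaE _ _ (B `^ alpha)).
  - exact: measurable_Omega.
  - apply: measurable_funTS.
    exact: (measurableT_comp measurable_kernel_Re (measurable_pairing xi)).
  - by move=> s /pairing_bounded-/(_ xi); exact: norm_kernel_Re.
under [RHS]eq_bigr do rewrite Im_prop ImD ImN.
apply: (@Rintegral_combination _ _ _ _ _ _ _ t0 GammaE _ _ (B `^ alpha)).
- exact: measurable_Omega.
- apply: measurable_funTS.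
  exact: (measurableT_comp measurable_kernel_Im (measurable_pairing xi)).
- by move=> s /pairing_bounded-/(_ xi); exact: norm_kernel_Im.
Qed.

End stable_kernel_theory.

(** * Riemann sums of complex functions *)

Section exponential_average.
Context {R : realType}.
Variable rate : R.
Hypothesis rate_gt0 : 0 < rate.

Let mu := @lebesgue_measure R.

Lemma exponential_integrable (h : R -> R) (C : R) : measurable_fun setT h ->
  (forall x, 0 <= x -> `|h x| <= C) ->
  mu.-integrable `[0, +oo[ (EFin \o fun x => h x * expR (- (rate * x))).
Proof.
move=> mh hC; pose D : set R := `[0, +oo[%classic.
have mD : measurable (D : set (measurableTypeR R)) by exact: measurable_itv.
have C0 : 0 <= C by exact: le_trans (hC 0 (lexx 0)).
have ipdf : mu.-integrable D (fun x => (C / rate)%:E * (exponential_pdf rate x)%:E)%E.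
  apply: integrableZl => //.
  by apply: integrableS (integrable_exponential_pdf rate_gt0).
have me : measurable_fun D (fun x : R => h x * expR (- (rate * x))).
  apply: measurable_funTS; apply: measurable_funM => //.
  apply: continuous_measurable_fun => x; apply: continuous_comp; last exact: continuous_expR.
  by apply: cvgN; apply: cvgM; [exact: cvg_cst|exact: cvg_id].
apply: (le_integrable mD _ _ ipdf); first exact/measurable_EFinP.
move=> x Dx; have x0 : 0 <= x by move: Dx; rewrite /D/= in_itv/= andbT.
rewrite -EFinM !abse_EFin lee_fin exponential_pdfE//.
rewrite mulrA mulfVK ?gt_eqF// mulNr !normrM ler_wpM2r// (ger0_norm C0).
exact: hC.
Qed.

Lemma exponential_riemann_complex (h : R -> R[i]) (C : R) :
  measurable_fun setT (fun x => complex.Re (h x)) ->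
  measurable_fun setT (fun x => complex.Im (h x)) ->
  (forall x, 0 <= x -> `|complex.Re (h x)| <= C) ->
  (forall x, 0 <= x -> `|complex.Im (h x)| <= C) ->
  (forall x, 0 < x -> {for x, continuous (fun x => complex.Re (h x))}) ->
  (forall x, 0 < x -> {for x, continuous (fun x => complex.Im (h x))}) ->
  ccvg (fun m => \sum_(i < (ncell m).+1)
    (exponential_mass rate (cell m i))%:C * h (grid m i))
  (rate%:C * cintegral lebesgue_measure `[0, +oo[ (fun x => h x * (expR (- (rate * x)))%:C)).
Proof.
move=> mR mI hR hI cR cI.
have part (u : R -> R) : measurable_fun setT u -> (forall x, 0 <= x -> `|u x| <= C) ->
    (forall x, 0 < x -> {for x, continuous u}) ->
    \sum_(i < (ncell m).+1) exponential_mass rate (cell m i) * u (grid m i) @[m --> \oo]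
    --> rate * \int[lebesgue_measure]_(x in `[0, +oo[) (u x * expR (- (rate * x))).
  move=> mu_ uC cu.
  have := @exponential_riemann _ _ rate_gt0 u C mu_ (fun x x0 => uC x (ltW x0)) cu.
  rewrite -RintegralZl//; last exact: exponential_integrable uC.
  by under [X in _ --> X -> _]eq_Rintegral do rewrite mulrCA.
split.
  rewrite Re_prop (_ : complex.Re (cintegral _ _ _) = \int[lebesgue_measure]_(x in `[0, +oo[)
      (complex.Re (h x) * expR (- (rate * x)))); last first.
    by apply: eq_Rintegral => x _; rewrite mulrC Re_prop mulrC.
  rewrite (_ : (fun m => _) = fun m => \sum_(i < (ncell m).+1)
      exponential_mass rate (cell m i) * complex.Re (h (grid m i))); first exact: part.
  by apply/funext => m; rewrite Re_sum; apply: eq_bigr => i _; rewrite Re_prop.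
rewrite Im_prop (_ : complex.Im (cintegral _ _ _) = \int[lebesgue_measure]_(x in `[0, +oo[)
    (complex.Im (h x) * expR (- (rate * x)))); last first.
  by apply: eq_Rintegral => x _; rewrite mulrC Im_prop mulrC.
rewrite (_ : (fun m => _) = fun m => \sum_(i < (ncell m).+1)
    exponential_mass rate (cell m i) * complex.Im (h (grid m i))); first exact: part.
by apply/funext => m; rewrite Im_sum; apply: eq_bigr => i _; rewrite Im_prop.
Qed.

End exponential_average.

(** * Homogeneity of the kernel and the one-dimensional spectral measure *)

Section kernel_homogeneous.
Context {R : realType}.
Variable alpha : R.
Hypothesis alpha_gt0 : 0 < alpha.

Lemma cpowNi_homogeneous (x b : R) : 0 <= b ->
  cpow (- 'i%C * (x * b)%:C) alpha = cpow (- 'i%C * x%:C) alpha * (b `^ alpha)%:C.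
Proof.
move=> b0; rewrite !cpowNi//.
have maxM (y : R) : Num.max (y * b) 0 = Num.max y 0 * b by rewrite maxr_pMl// mul0r.
rewrite [RHS]mulrC; apply: complex_ext; rewrite ?Re_prop ?Im_prop/=.
  by rewrite /kernel_Re normrM (ger0_norm b0) powRM//; ring.
rewrite /kernel_Im -mulNr !maxM !powRM ?le_max ?lexx ?orbT//; ring.
Qed.

(** In dimension one [Omega] is reduced to the point [1], where the kernel is [(-i x)^alpha]. *)
Lemma cintegral_stable_kernel1 (Gamma : {finite_measure set (1.-tuple R) -> \bar R}) (x : R) :
  Gamma (~` Omega 1) = 0%E ->
  cintegral Gamma (Omega 1) (stable_kernel alpha (const_mx x)) =
  (fine (Gamma [set: 1.-tuple R]))%:C * cpow (- 'i%C * x%:C) alpha.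
Proof.
move=> Gamma0.
have GammaE : Gamma (Omega 1) = Gamma setT.
  rewrite -(setUv (Omega 1)) measureU//; last by rewrite setICr.
  - by rewrite -[LHS]adde0; congr (_ + _)%E; exact/esym.
  - exact: measurable_Omega.
  - by apply: measurableC; exact: measurable_Omega.
have kE (s : 1.-tuple R) : Omega 1 s ->
    stable_kernel alpha (const_mx x) s = cpow (- 'i%C * x%:C) alpha.
  move=> [+ s0 _]; rewrite big_ord1 => s1.
  rewrite /stable_kernel big_ord1 mxE.
  have -> : tnth s ord0 = 1.
    by apply/eqP; rewrite -(@eqrXn2 _ 2)// expr1n s1.
  by rewrite mulr1.
move: (cpow _ _) kE => z kE; rewrite -GammaE.
apply: complex_ext; rewrite ?Re_prop ?Im_prop.
  rewrite [LHS](@eq_Rintegral _ _ _ Gamma _ (fun=> complex.Re z)).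
    by rewrite [RHS]mulrC (Rintegral_cst _ (@measurable_Omega R 1%N)).
  by move=> s /set_mem/kE ->.
rewrite [LHS](@eq_Rintegral _ _ _ Gamma _ (fun=> complex.Im z)).
  by rewrite [RHS]mulrC (Rintegral_cst _ (@measurable_Omega R 1%N)).
by move=> s /set_mem/kE ->.
Qed.

End kernel_homogeneous.

(** * Equality in distribution *)

Lemma cvg_ramp_indic (R : realType) (x y : R) :
  Num.min 1 (Num.max 0 (m.+1%:R * (y - x))) @[m --> \oo] --> (\1_(`]x, +oo[%classic) y : R).
Proof.
rewrite indicE; have [xy|yx] := ltP x y.
  rewrite mem_set/= ?in_itv/= ?xy//.
  apply: cvg_near_cst; near=> m; rewrite min_l// le_max; apply/orP; right.
  rewrite -ler_pdivrMr ?subr_gt0// mul1r -natr1 ler_wpDr// ltW//.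
  by near: m; exact: nbhs_infty_gtr.
rewrite memNset/= ?in_itv/= ?andbT; last by apply/negP; rewrite -leNgt.
apply: cvg_near_cst; apply: nearW => m.
by rewrite max_l ?mulr_ge0_le0 ?subr_le0// min_r.
Unshelve. all: by end_near. Qed.

Section equality_in_distribution.
Context {R : realType} d (T : measurableType d) (P : probability T R).

(** Ramps vanishing up to [x] converge everywhere to the indicator of the open ray, so the two laws
    agree on open rays, a class stable under intersection that generates the Borel sets. *)
Lemma eq_dist_bounded_continuous (X Y : {RV P >-> R}) :
  (forall g : R -> R, continuous g -> (forall x, `|g x| <= 1) ->
    \int[P]_w g (X w) = \int[P]_w g (Y w)) ->
  eq_dist P X Y.
Proof.
move=> XY.
have ray (x : R) : P (X @^-1` `]x, +oo[) = P (Y @^-1` `]x, +oo[).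
  pose g m (y : R) : R := Num.min 1 (Num.max 0 (m.+1%:R * (y - x))).
  have g_cont m : continuous (g m).
    move=> y; apply: (@continuous_min _ _ (fun=> 1) (fun y => Num.max 0 (m.+1%:R * (y - x)))).
      exact: cvg_cst.
    apply: (@continuous_max _ _ (fun=> 0) (fun y => (m.+1%:R * (y - x)))).
      exact: cvg_cst.
    apply: cvgM; first exact: cvg_cst.
    by apply: cvgB; [exact: cvg_id|exact: cvg_cst].
  have g_bounded m y : `|g m y| <= 1.
    by rewrite ger0_norm ?le_min ?ler01 ?le_max ?lexx// ge_min lexx.
  have lim (Z : {RV P >-> R}) :
      \int[P]_w g m (Z w) @[m --> \oo] --> fine (P (Z @^-1` `]x, +oo[)).
    have mZ : measurable (Z @^-1` `]x, +oo[).
      by rewrite -[X in measurable X]setTI; exact: measurable_funP.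
    have -> : fine (P (Z @^-1` `]x, +oo[)) = \int[P]_w (\1_(Z @^-1` `]x, +oo[) w).
      by rewrite /Rintegral integral_indic// setIT.
    apply: (@Rintegral_cvg_bounded _ _ _ _ _ _ 1) => //.
    - move=> m; apply: measurableT_comp => //; exact: continuous_measurable_fun.
    - apply: aeW => w; exact: cvg_ramp_indic.
  have e : fine (P (X @^-1` `]x, +oo[)) = fine (P (Y @^-1` `]x, +oo[)).
    have limX := lim X; rewrite (_ : (fun m => _) = fun m => \int[P]_w g m (Y w)) in limX.
      exact: cvg_unique (lim Y).
    by apply/funext => m; exact: XY.
  have mZ (Z : {RV P >-> R}) : measurable (Z @^-1` `]x, +oo[).
    by rewrite -[X in measurable X]setTI; exact: measurable_funP.
  by rewrite -(fineK (fin_num_measure P _ (mZ X))) e fineK// fin_num_measure.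
move=> A mA.
have G_cap : setI_closed (@RGenOInfty.G R).
  move=> _ _ [x ->] [y ->]; exists (Num.max x y); apply/seteqP; split => z /=.
    by rewrite !in_itv/= !andbT gt_max => -[-> ->].
  by rewrite !in_itv/= !andbT gt_max => /andP.
have G_cover : \bigcup_k `](- k%:R : R), +oo[%classic = setT.
  apply/seteqP; split => // z _; exists (Num.bound `|z|) => //=; rewrite in_itv/= andbT.
  by rewrite ltrNl (le_lt_trans (ler_norm _))// normrN archi_boundP.
apply: (measure_unique (@RGenOInfty.G R) (fun k => `](- k%:R : R), +oo[%classic) _
  G_cap _ G_cover (distribution P X) (distribution P Y)) => //.
- exact: RGenOInfty.measurableE.
- by move=> k; eexists; reflexivity.
- by move=> _ [x ->]; exact: ray.
- by move=> k; rewrite ltey_eq fin_num_measure.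
Qed.

Lemma eq_dist_Rintegral d' (S : measurableType d') (X Y : T -> S) (g : S -> R) (C : R) :
  measurable_fun setT X -> measurable_fun setT Y -> measurable_fun setT g ->
  (forall x, `|g x| <= C) -> eq_dist P X Y ->
  \int[P]_w g (X w) = \int[P]_w g (Y w).
Proof.
move=> mX mY mg gC XY.
have law (Z : T -> S) (mZ : measurable_fun setT Z) :
    (\int[P]_w (g (Z w))%:E = \int[pushforward P Z]_x (g x)%:E)%E.
  rewrite integral_pushforward//; first exact/measurable_EFinP.
  apply: (@bounded_integrable _ _ _ P setT (g \o Z) C) => //.
    exact: measurableT_comp.
  by move=> w _; exact: gC.
rewrite /Rintegral !law//; congr fine.
by apply: eq_measure_integral => A mA _; exact: XY.
Qed.

End equality_in_distribution.

(** * The waiting times *)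

Section finite_sums.
Context {R : realType}.

Lemma sum_ffun_prod n m (p : 'I_m -> R) (psi : 'I_n -> 'I_m -> R[i]) :
  \sum_(f : {ffun 'I_n -> 'I_m}) (\prod_(k < n) p (f k))%:C * \prod_(k < n) psi k (f k) =
  \prod_(k < n) \sum_(i < m) (p i)%:C * psi k i.
Proof.
by rewrite bigA_distr_bigA; apply: eq_bigr => f _; rewrite rmorph_prod -big_split.
Qed.

Definition cumul n (w : 'I_n -> R) (j : nat) : R := \sum_(l < n | (l < j)%N) w l.

(** Exchange of summations: the length [w k] enters every time of index at least [k]. The tail sums
    in the announced formula come from here. *)
Lemma cumul_sum n (w : 'I_n -> R) (I : 'I_n -> R[i]) :
  \sum_(j < n) (cumul w j.+1)%:C * I j =
  \sum_(k < n) (w k)%:C * \sum_(j < n | (k <= j)%N) I j.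
Proof.
under eq_bigr do rewrite rmorph_sum/= mulr_suml.
under [RHS]eq_bigr do rewrite mulr_sumr.
by rewrite (exchange_big_dep xpredT).
Qed.

Lemma ordered_cumul n (w : 'I_n -> R) : (forall k, 0 < w k) ->
  ordered_times [tuple cumul w i.+1 | i < n].
Proof.
move=> w0; split=> [i|i j ij]; rewrite ?tnth_mktuple.
  by apply: sumr_ge0 => l _; exact/ltW.
rewrite /cumul [ltRHS](bigD1 j)//= addrC ltr_pwDr//.
rewrite [leRHS](bigID (fun l : 'I_n => (l < i.+1)%N))/=.
rewrite (eq_bigl (fun l : 'I_n => (l < j.+1)%N && (l != j) && (l < i.+1)%N)).
  by rewrite lerDl sumr_ge0// => l _; exact/ltW.
move=> l; apply/idP/idP => [li|/andP[]//]; rewrite li andbT.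
have lj : (l < j)%N by rewrite (leq_ltn_trans _ ij).
by rewrite ltnS (ltnW lj)/= -val_eqE/= ltn_eqF.
Qed.

(** [A_mx n] sends the values [a 1, ..., a n] to their increments, and its transpose moves the
    differencing onto [xi]. The first row of [K_mx n] is zero, which matches [a 0 = 0]. *)
Lemma pairing_A_mx n (xi : 'cV[R]_n) (a : nat -> R) : a 0%N = 0 ->
  \sum_(k < n) xi k 0 * (a k.+1 - a k) =
  \sum_(i < n) ((A_mx n)^T *m xi) i 0 * a i.+1.
Proof.
move=> a0.
have -> : \sum_(i < n) ((A_mx n)^T *m xi) i 0 * a i.+1 =
    \sum_(k < n) xi k 0 * \sum_(i < n) A_mx n k i * a i.+1.
  under eq_bigr do rewrite mxE mulr_suml.
  rewrite exchange_big/=; apply: eq_bigr => k _; rewrite mulr_sumr.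
  by apply: eq_bigr => i _; rewrite mxE; ring.
apply: eq_bigr => k _; congr (_ * _).
under eq_bigr do rewrite !mxE mulrBl.
rewrite sumrB; congr (_ - _).
  rewrite (bigD1 k)//= eqxx mul1r big1 ?addr0// => i ik.
  by rewrite eq_sym (negbTE ik) mul0r.
case: k => -[|k] kn /=.
  by rewrite a0 big1// => i _; rewrite mul0r.
rewrite (bigD1 (Ordinal (ltnW kn)))//= eqxx mul1r big1 ?addr0// => i ik.
rewrite eqSS [_ == _](_ : _ = false) ?mul0r//.
by apply: contraNF ik => /eqP ki; apply/eqP/val_inj.
Qed.

End finite_sums.

Lemma cexp_i (R : realType) (x : R) : cexp ('i%C * x%:C) = cis x.
Proof.
have -> : 'i%C * x%:C = Complex 0 x by apply: complex_ext; rewrite ?ReM ?ImM/=; ring.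
by rewrite /cexp/= expR0 mul1r.
Qed.

Section characteristic_functions.
Context {R : realType} d (T : measurableType d).

Lemma Re_cintegral_cis (mu : {measure set T -> \bar R}) (X : T -> R) :
  complex.Re (cintegral mu setT (fun w => cexp ('i%C * (X w)%:C))) = \int[mu]_w cos (X w).
Proof. by apply: eq_Rintegral => w _; rewrite cexp_i. Qed.

Lemma Im_cintegral_cis (mu : {measure set T -> \bar R}) (X : T -> R) :
  complex.Im (cintegral mu setT (fun w => cexp ('i%C * (X w)%:C))) = \int[mu]_w sin (X w).
Proof. by apply: eq_Rintegral => w _; rewrite cexp_i. Qed.

Lemma ae_eq_cintegral_cis (mu : {measure set T -> \bar R}) (X Y : T -> R) :
  measurable_fun setT X -> measurable_fun setT Y -> {ae mu, forall w, X w = Y w} ->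
  cintegral mu setT (fun w => cexp ('i%C * (X w)%:C)) =
  cintegral mu setT (fun w => cexp ('i%C * (Y w)%:C)).
Proof.
move=> mX mY XY.
have trig (g : R -> R) : continuous g -> \int[mu]_w g (X w) = \int[mu]_w g (Y w).
  move=> /continuous_measurable_fun mg; apply: ae_eq_Rintegral.
  - exact: measurableT_comp.
  - exact: measurableT_comp.
  - by apply: filterS XY => w ->.
apply: complex_ext; rewrite ?Re_cintegral_cis ?Im_cintegral_cis; apply: trig.
  exact: continuous_cos.
exact: continuous_sin.
Qed.

Lemma eq_dist_cintegral_cis (P : probability T R) (X Y : T -> R) :
  measurable_fun setT X -> measurable_fun setT Y -> eq_dist P X Y ->
  cintegral P setT (fun w => cexp ('i%C * (X w)%:C)) =
  cintegral P setT (fun w => cexp ('i%C * (Y w)%:C)).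
Proof.
move=> mX mY XY; apply: complex_ext; rewrite ?Re_cintegral_cis ?Im_cintegral_cis.
  apply: (@eq_dist_Rintegral _ _ _ _ _ _ _ _ _ 1) => //.
    by apply: continuous_measurable_fun; exact: continuous_cos.
  by move=> x; rewrite ler_norml cos_geN1 cos_le1.
apply: (@eq_dist_Rintegral _ _ _ _ _ _ _ _ _ 1) => //.
  by apply: continuous_measurable_fun; exact: continuous_sin.
by move=> x; rewrite ler_norml sin_geN1 sin_le1.
Qed.

End characteristic_functions.

Section waiting_times.
Context {R : realType} d (T : measurableType d) (P : probability T R).
Context d' (S : measurableType d').
Variables (lambda : R) (Mt : nat -> {RV P >-> S}) (N : R -> {RV P >-> nat}).
Variables (W J : nat -> {RV P >-> R}) (sigma : R -> {RV P >-> R}).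
Hypothesis lambda_gt0 : 0 < lambda.
Hypothesis N_poisson : poisson_process lambda N W.
Hypothesis sigma_lt :
  {ae P, forall w, forall s t : R, 0 <= s -> s < t -> sigma s w < sigma t w}.
Hypothesis sigma_indep : independent_systems P
  (sigma_gen [set t : R | 0 <= t] sigma)
  <<s sigma_gen [set: nat] Mt `|` sigma_gen [set t : R | 0 <= t] N >>.
Hypothesis sigma0 : {ae P, forall w, sigma 0 w = 0}.
Hypothesis J_waiting :
  interarrival_times P (fun t w => N (inverse_process sigma t w) w) J.

Let m_RV d0 (T0 : measurableType d0) (X : {RV P >-> T0}) : measurable_fun setT X.
Proof. exact: measurable_funP. Qed.

Let exponential_le0 : exponential_prob lambda `]-oo, 0] = 0%E.
Proof.
(* The endpoint is removed first, since the density is not zero at [0]. *)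
rewrite /exponential_prob -integral_itv_bndo_bndc.
  apply: integral0_eq => x; rewrite /= in_itv/= => x0.
  by rewrite lt0_exponential_pdf.
by apply/measurable_EFinP; apply: measurable_funTS; exact: measurable_exponential_pdf.
Qed.

Let W_gt0 : {ae P, forall w, forall k, 0 < W k w}.
Proof.
apply/ae_foralln => k; exists (W k @^-1` `]-oo, 0]); split.
- by rewrite -[X in measurable X]setTI; exact: m_RV.
- have [[/(_ k `]-oo, 0]%classic) WE _] _] := N_poisson.
  by rewrite -exponential_le0 -WE.
- by move=> w /= /negP; rewrite -leNgt in_itv.
Qed.

Let W_indep n (B : nat -> set R) : (forall k, measurable (B k)) ->
  P (\bigcap_(k < n) (W k @^-1` B k)) = (\prod_(k < n) exponential_mass lambda (B k))%:E.
Proof.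
move=> mB; have [[WE Wi] _] := N_poisson.
rewrite Wi// -prodEFin; apply: eq_bigr => k _.
by rewrite -exponential_massE//; exact: WE.
Qed.

Let W_sigma F n (B : nat -> set R) : (forall k, measurable (B k)) ->
  sigma_gen [set t : R | 0 <= t] sigma F ->
  P (F `&` \bigcap_(k < n) (W k @^-1` B k)) =
  (P F * P (\bigcap_(k < n) (W k @^-1` B k)))%E.
Proof.
move=> mB sF.
have [_ N_W] := N_poisson.
(* The complement of the measurable null set [A] plays the role of [Z]; the set where the two
   properties hold need not itself be measurable. *)
have [A [mA A0 AZ]] := filterI W_gt0 N_W.
have goodP w : (~` A) w -> (forall k, 0 < W k w) /\ forall (t : R) (n : nat), 0 <= t ->
    N t w = n <-> psum (W^~ w) n <= t < psum (W^~ w) n.+1.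
  by move=> Aw; apply: contrapT => h; apply: Aw; apply: AZ.
have := sigma_indep; set G := <<s _ >> => sigma_G.
have mN t : measurable_fun setT (N t) by exact: m_RV.
have G_sub : G `<=` measurable.
  apply: smallest_sub; first exact: sigma_algebra_measurable.
  by move=> E [|]; apply: sigma_gen_measurable => i _; exact: m_RV.
apply: (@indep_interarrival _ _ _ P N (fun k => W k : T -> R) G (~` A)) => //.
- exact: smallest_sigma_algebra.
- exact: measurableC.
- by rewrite setCK.
- move=> t E t0; apply: sub_sigma_algebra; right; apply: sub_sigma_algebra.
  by exists t => //; exists E; rewrite // setTI.
- by move=> w /goodP[].
- by move=> w /goodP[].
- apply: (sigma_gen_measurable (D := [set t : R | 0 <= t]) (X := fun t => sigma t : T -> R)) => //.
- by move=> E GE; exact: sigma_G.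
Qed.

Let J_limit : {ae P, forall w, forall (n : nat) (a : nat -> R), (0 < n)%N ->
  (\forall m \near \oo, 0 <= a m < psum (W^~ w) n) -> a @ \oo --> psum (W^~ w) n ->
  sigma (a m) w @[m --> \oo] --> psum (J^~ w) n}.
Proof.
have [_ N_W] := N_poisson.
apply: filterS (filterI (filterI W_gt0 N_W) (filterI (filterI sigma_lt sigma0) J_waiting)).
move=> w [[W0 NW] [[slt s0] NJ]] n a n0 a_lt a_cvg.
exact: (@jump_time_left_limit _ (sigma^~ w) (N^~ w) (W^~ w) (J^~ w)).
Qed.

Lemma waiting_times_cvg (g : R -> R) (C : R) (n : nat) (c : 'I_n -> R) :
  continuous g -> (forall x, `|g x| <= C) ->
  \sum_(f : {ffun 'I_n -> 'I_(ncell m).+1})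
    (\prod_(k < n) exponential_mass lambda (cell m (f k))) *
    \int[P]_w g (\sum_(k < n) c k * (sigma (grid_time f k.+1) w - sigma (grid_time f k) w))
  @[m --> \oo] --> \int[P]_w g (\sum_(k < n) c k * J k w).
Proof.
move=> g_cont g_bounded.
apply: (@Rintegral_jumps_cvg _ _ _ P (fun t => sigma t : T -> R) (fun k => W k : T -> R)
  (fun k => J k : T -> R) (exponential_mass lambda)) => //; exact: g_bounded.
Qed.

(** Cosine and sine are the test functions. With [phi] left free, each part of the theorem supplies
    its own closed form of the characteristic functions. *)
Lemma waiting_times_ccvg (n : nat) (c : 'I_n -> R)
    (phi : forall m, {ffun 'I_n -> 'I_(ncell m).+1} -> R[i]) :
  (forall m f, phi m f = cintegral P setT (fun w => cexp ('i%C *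
    (\sum_(k < n) c k * (sigma (grid_time f k.+1) w - sigma (grid_time f k) w))%:C))) ->
  ccvg (fun m => \sum_(f : {ffun 'I_n -> 'I_(ncell m).+1})
    (\prod_(k < n) exponential_mass lambda (cell m (f k)))%:C * phi m f)
  (cintegral P setT (fun w => cexp ('i%C * (\sum_(k < n) c k * J k w)%:C))).
Proof.
move=> phiE; split.
  rewrite Re_cintegral_cis (_ : (fun m => _) = fun m =>
    \sum_(f : {ffun 'I_n -> 'I_(ncell m).+1})
      (\prod_(k < n) exponential_mass lambda (cell m (f k))) * \int[P]_w
      cos (\sum_(k < n) c k * (sigma (grid_time f k.+1) w - sigma (grid_time f k) w))).
    apply: (@waiting_times_cvg _ 1); first exact: continuous_cos.
    by move=> x; rewrite ler_norml cos_geN1 cos_le1.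
  apply/funext => m; rewrite Re_sum; apply: eq_bigr => f _.
  by rewrite Re_prop phiE Re_cintegral_cis.
rewrite Im_cintegral_cis (_ : (fun m => _) = fun m =>
  \sum_(f : {ffun 'I_n -> 'I_(ncell m).+1})
    (\prod_(k < n) exponential_mass lambda (cell m (f k))) * \int[P]_w
    sin (\sum_(k < n) c k * (sigma (grid_time f k.+1) w - sigma (grid_time f k) w))).
  apply: (@waiting_times_cvg _ 1); first exact: continuous_sin.
  by move=> x; rewrite ler_norml sin_geN1 sin_le1.
apply/funext => m; rewrite Im_sum; apply: eq_bigr => f _.
by rewrite Im_prop phiE Im_cintegral_cis.
Qed.

Section stable.
Variable alpha : R.
Hypotheses (alpha_gt0 : 0 < alpha) (alpha_lt1 : alpha < 1).
Variables (n : nat) (nu : 'I_n -> {charge set (n.-tuple R) -> \bar R}).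
Hypothesis sigma_spectral : forall t : n.-tuple R, ordered_times t ->
  exists2 Gamma, spectral_measure alpha sigma t Gamma &
    forall A : set (n.-tuple R), measurable A ->
      Gamma A = (\sum_(j < n) (tnth t j)%:E * nu j A)%E.
Variable xi : 'cV[R]_n.

Let exponent (k : 'I_n) : R[i] := \sum_(j < n | (k <= j)%N)
  charge_cintegral (nu j) (Omega n) (stable_kernel alpha ((A_mx n)^T *m xi)).

Let exponentE (w : 'I_n -> R) : (forall k, 0 < w k) ->
  exists2 Gamma, spectral_measure alpha sigma [tuple cumul w i.+1 | i < n] Gamma &
    cintegral Gamma (Omega n) (stable_kernel alpha ((A_mx n)^T *m xi)) =
    \sum_(k < n) (w k)%:C * exponent k.
Proof.
move=> w0; have [Gamma GammaP GammaE] := sigma_spectral (ordered_cumul w0).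
exists Gamma => //; rewrite -cumul_sum.
apply: (@cintegral_combination _ _ alpha_gt0 _ Gamma nu (fun j => cumul w j.+1)).
  by move=> j; apply: sumr_ge0 => l _; exact/ltW.
by move=> A mA; rewrite GammaE//; apply: eq_bigr => j _; rewrite tnth_mktuple.
Qed.

Let Re_exponent_ge0 k : 0 <= complex.Re (exponent k).
Proof.
(* Take the increment [1] at [k] and arbitrarily small increments elsewhere. *)
apply/ler_addgt0Pr => e e0.
(* The [+ 1] makes [B] positive, even for an empty sum; increments [e / B] then contribute at most
   [e] in total. *)
pose B := \sum_(l < n | l != k) `|complex.Re (exponent l)| + 1.
have B0 : 0 < B by rewrite ltr_pwDr// sumr_ge0.
pose w (l : 'I_n) : R := if l == k then 1 else e / B.
have w0 l : 0 < w l by rewrite /w; case: ifP => // _; rewrite divr_gt0.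
have [Gamma _ GammaE] := exponentE w0.
have := Re_cintegral_stable_kernel_ge0 alpha_gt0 alpha_lt1 Gamma ((A_mx n)^T *m xi).
rewrite GammaE Re_sum; under eq_bigr do rewrite Re_prop.
rewrite (bigD1 k)//= {1}/w eqxx mul1r => /le_trans; apply; rewrite lerD2l.
rewrite (@le_trans _ _ (\sum_(l < n | l != k) e / B * `|complex.Re (exponent l)|))//.
  apply: ler_sum => l lk; rewrite /w (negbTE lk) ler_wpM2l ?ler_norm//.
  by rewrite divr_ge0// ltW.
rewrite -mulr_sumr mulrAC ler_pdivrMr// ler_pM2l//.
by rewrite /B lerDl.
Qed.

Lemma stable_waiting_times :
  char_fun P (fun k : 'I_n => J k) xi =
  \prod_(k < n) (lambda%:C / (lambda%:C + exponent k)).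
Proof.
pose phi m (f : {ffun 'I_n -> 'I_(ncell m).+1}) : R[i] :=
  \prod_(k < n) cexp (- (exponent k * (grid m (f k))%:C)).
have phiE m f : phi m f = cintegral P setT (fun w => cexp ('i%C *
    (\sum_(k < n) xi k 0 * (sigma (grid_time f k.+1) w - sigma (grid_time f k) w))%:C)).
  have g0 (k : 'I_n) : 0 < grid m (f k) :> R by exact: grid_gt0.
  have [Gamma [_ /(_ ((A_mx n)^T *m xi)) GammaP] GammaE] := exponentE g0.
  transitivity (char_fun P (fun i : 'I_n =>
    sigma (tnth [tuple cumul (fun k => grid m (f k)) i.+1 | i < n] i)) ((A_mx n)^T *m xi)).
    rewrite GammaP GammaE -sumrN cexp_sum; apply: eq_bigr => k _.
    by rewrite mulrC.
  apply: ae_eq_cintegral_cis.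
  - by apply: measurable_sum => i; apply: measurable_funM => //; exact: m_RV.
  - apply: measurable_sum => i; apply: measurable_funM => //.
    by apply: measurable_funB; exact: m_RV.
  - apply: filterS sigma0 => w s0.
    rewrite (@pairing_A_mx _ n xi (fun k => sigma (grid_time f k) w)); last by rewrite grid_time0.
    (* [grid_time f] is convertible to [cumul] of the chosen grid points. *)
    by apply: eq_bigr => i _; rewrite tnth_mktuple.
have lim1 := waiting_times_ccvg (c := fun k => xi k 0) phiE.
apply: (ccvg_unique lim1).
have -> : (fun m => \sum_(f : {ffun 'I_n -> 'I_(ncell m).+1})
    (\prod_(k < n) exponential_mass lambda (cell m (f k)))%:C * phi m f) =
    fun m => \prod_(k < n) \sum_(i < (ncell m).+1)
      (exponential_mass lambda (cell m i))%:C * cexp (- (exponent k * (grid m i)%:C)).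
  apply/funext => m; exact: (sum_ffun_prod (fun i => exponential_mass lambda (cell m i))).
by apply: ccvg_prod => k; apply: exponential_laplace.
Qed.

End stable.

Section stationary.
Hypothesis sigma_stationary : stationary_increments sigma.

Let increment_law (g : R -> R) (C t b : R) : continuous g -> (forall x, `|g x| <= C) ->
  0 <= t -> 0 <= b -> \int[P]_w g (sigma (t + b) w - sigma t w) = \int[P]_w g (sigma b w).
Proof.
move=> g_cont g_bounded t0 b0.
apply: (@eq_dist_Rintegral _ _ _ _ _ _ (fun w => sigma (t + b) w - sigma t w)
  (sigma b) g C) => //.
- by apply: measurable_funB; exact: m_RV.
- exact: continuous_measurable_fun.
- by rewrite addrC; exact: sigma_stationary.
Qed.

Let cell_mass m (i : 'I_(ncell m).+1) : R := exponential_mass lambda (cell m i).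

(** The Laplace limit at [c = 0]. *)
Let total_mass_cvg : \sum_(i < (ncell m).+1) cell_mass i @[m --> \oo] --> (1 : R).
Proof.
have [+ _] := @exponential_laplace _ _ lambda_gt0 0 (lexx 0).
rewrite addr0 divff; last by rewrite eq_complex/= negb_and gt_eqF.
apply: cvg_trans; apply: near_eq_cvg; apply: nearW => m.
rewrite Re_sum; apply: eq_bigr => i _.
by rewrite mul0r oppr0 cexp0 Re_prop mulr1.
Qed.

(** The coefficients [c] select the last of [k + 1] increments. By stationarity its law ignores the
    earlier cells, so summing over each of these leaves one factor of total mass. *)
Let waiting_time_cvg (g : R -> R) (C : R) (k : nat) :
  continuous g -> (forall x, `|g x| <= C) ->
  (\sum_(i < (ncell m).+1) cell_mass i) ^+ k *
  \sum_(i < (ncell m).+1) cell_mass i * \int[P]_w g (sigma (grid m i) w)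
    @[m --> \oo] --> \int[P]_w g (J k w).
Proof.
move=> g_cont g_bounded; pose c (l : 'I_k.+1) : R := (l == ord_max)%:R.
have pick (a : 'I_k.+1 -> R) : \sum_(l < k.+1) c l * a l = a ord_max.
  rewrite (bigD1 ord_max)//= /c eqxx mul1r big1 ?addr0// => l /negbTE ->.
  by rewrite mul0r.
have := waiting_times_cvg (c := c) g_cont g_bounded.
under [X in _ --> X -> _]eq_Rintegral do rewrite (pick (fun l => J l _)).
rewrite (_ : (fun m => _) = fun m => (\sum_(i < (ncell m).+1) cell_mass i) ^+ k *
  \sum_(i < (ncell m).+1) cell_mass i * \int[P]_w g (sigma (grid m i) w)) //.
apply/funext => m.
pose F (l : 'I_k.+1) (i : 'I_(ncell m).+1) : R := if l == ord_max
  then cell_mass i * \int[P]_w g (sigma (grid m i) w) else cell_mass i.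
transitivity (\prod_(l < k.+1) \sum_(i < (ncell m).+1) F l i).
  rewrite bigA_distr_bigA; apply: eq_bigr => f _.
  under eq_Rintegral do
    rewrite (pick (fun l => sigma (grid_time f l.+1) _ - sigma (grid_time f l) _)).
  rewrite grid_timeS (increment_law g_cont g_bounded) ?grid_time_ge0//; last exact/ltW/grid_gt0.
  rewrite [RHS]big_ord_recr/= [X in X * _]big_ord_recr/= /F eqxx mulrA; congr (_ * _ * _).
  apply: eq_bigr => l _; rewrite ifF//.
  by apply/negbTE; rewrite -val_eqE/= ltn_eqF.
rewrite big_ord_recr/= /F eqxx; congr (_ * _).
rewrite -[in RHS](card_ord k) -prodr_const; apply: eq_bigr => l _.
apply: eq_bigr => i _; rewrite ifF//.
by apply/negbTE; rewrite -val_eqE/= ltn_eqF.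
Qed.

(** The approximations for [J k] and [J 0] differ by the [k]-th power of the total mass, which tends
    to [1]. *)
Lemma stationary_waiting_times k : eq_dist P (J k) (J 0%N).
Proof.
apply: eq_dist_bounded_continuous => g g_cont g_bounded.
have lim0 : \sum_(i < (ncell m).+1) cell_mass i * \int[P]_w g (sigma (grid m i) w)
    @[m --> \oo] --> \int[P]_w g (J 0 w).
  have := waiting_time_cvg (k := 0) g_cont g_bounded; apply: cvg_trans.
  by apply: near_eq_cvg; apply: nearW => m; rewrite expr0 mul1r.
have lim_mass : (\sum_(i < (ncell m).+1) cell_mass i) ^+ k @[m --> \oo] --> (1 : R).
  rewrite -(expr1n _ k); apply: (@continuous_cvg _ _ _ _ _ _ (fun x : R => x ^+ k) 1).
    exact: exprn_continuous.
  exact: total_mass_cvg.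
have limk := waiting_time_cvg (k := k) g_cont g_bounded.
have lim : (\sum_(i < (ncell m).+1) cell_mass i) ^+ k *
    \sum_(i < (ncell m).+1) cell_mass i * \int[P]_w g (sigma (grid m i) w)
    @[m --> \oo] --> 1 * \int[P]_w g (J 0 w) by exact: cvgM.
by rewrite mul1r in lim; exact: cvg_unique lim.
Qed.

End stationary.

Section self_similar_stationary.
Hypothesis sigma_stationary : stationary_increments sigma.
Variables alpha H : R.
Hypotheses (alpha_gt0 : 0 < alpha) (alpha_lt1 : alpha < 1).
Hypothesis sigma_ss : self_similar H sigma.
Variable Gamma : {finite_measure set (1.-tuple R) -> \bar R}.
Hypothesis Gamma_spectral : spectral_measure alpha sigma [tuple 1] Gamma.
Variable xi : R.

Let kappa : R[i] := cpow (- 'i%C * xi%:C) alpha.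
Let gamma : R := fine (Gamma [set: 1.-tuple R]).
Let h (b : R) : R[i] := cexp (- gamma%:C * kappa * (b `^ (H * alpha))%:C).

Let eq_dist_scaled (b : R) : 0 < b -> eq_dist P (sigma b) (fun w => b `^ H * sigma 1 w).
Proof.
move=> b0 A mA.
have t0 : nonneg_times [tuple (1 : R)] by move=> i; rewrite (tnth_nth 0) ord1/= ler01.
have mA' : measurable ((fun s : 1.-tuple R => tnth s ord0) @^-1` A).
  by rewrite -[X in measurable X]setTI; apply: measurable_tnth.
have := sigma_ss b0 t0 mA'.
have E (X : 'I_1 -> T -> R) : (fun w => [tuple X i w | i < 1]) @^-1`
    ((fun s : 1.-tuple R => tnth s ord0) @^-1` A) = X ord0 @^-1` A.
  by apply/seteqP; split => w; rewrite /= tnth_mktuple.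
rewrite (E (fun i w => sigma (b * tnth [tuple 1] i) w)).
rewrite (E (fun i w => b `^ H * sigma (tnth [tuple 1] i) w)).
by rewrite !(tnth_nth 0)/= mulr1.
Qed.

(** Self-similarity replaces [sigma b] by [b^H sigma 1], and the kernel is homogeneous of degree
    [alpha], whence the exponent [H * alpha]. *)
Let charfun_sigma (b : R) : 0 < b ->
  cintegral P setT (fun w => cexp ('i%C * (xi * sigma b w)%:C)) = h b.
Proof.
move=> b0; pose x := xi * b `^ H.
have [Gamma0 /(_ (const_mx x)) charE] := Gamma_spectral.
transitivity (char_fun P (fun i : 'I_1 => sigma (tnth [tuple 1] i)) (const_mx x)).
  transitivity (cintegral P setT (fun w => cexp ('i%C * (x * sigma 1 w)%:C))).
    apply: eq_dist_cintegral_cis.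
    - by apply: measurable_funM => //; exact: m_RV.
    - by apply: measurable_funM => //; exact: m_RV.
    - move=> A mA.
      have mA' : measurable ((fun y : R => xi * y) @^-1` A).
        by rewrite -[X in measurable X]setTI; apply: measurable_funM.
      have := eq_dist_scaled b0 mA'; rewrite /x => e; rewrite [LHS]e.
      by congr (P _); apply/seteqP; split => w /=; rewrite mulrA.
  rewrite /char_fun; congr cintegral; apply/funext => w.
  by rewrite big_ord1 mxE (tnth_nth 0).
rewrite charE cintegral_stable_kernel1// /x cpowNi_homogeneous ?powR_ge0// -powRrM.
by rewrite -/gamma -/kappa /h; congr cexp; ring.
Qed.

Let gamma_ge0 : 0 <= gamma.
Proof. by rewrite fine_ge0. Qed.

Let Re_kappa_ge0 : 0 <= complex.Re kappa.
Proof. by rewrite /kappa cpowNi//; exact: kernel_Re_ge0. Qed.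

Let Re_exponent (b : R) : complex.Re (- gamma%:C * kappa * (b `^ (H * alpha))%:C) =
  - (gamma * complex.Re kappa) * b `^ (H * alpha).
Proof. by rewrite mulrC Re_prop mulNr ReN Re_prop mulrC. Qed.

Let Im_exponent (b : R) : complex.Im (- gamma%:C * kappa * (b `^ (H * alpha))%:C) =
  - (gamma * complex.Im kappa) * b `^ (H * alpha).
Proof. by rewrite mulrC Im_prop mulNr ImN Im_prop mulrC. Qed.

Let Re_exponent_le0 (b : R) :
  complex.Re (- gamma%:C * kappa * (b `^ (H * alpha))%:C) <= 0.
Proof. by rewrite Re_exponent mulNr oppr_le0 !mulr_ge0// powR_ge0. Qed.

Let continuous_scaled (u : R -> R) (a : R) : continuous u -> continuous (fun y => u (a * y)).
Proof.
move=> cu y; apply: continuous_comp; last exact: cu.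
by apply: cvgM; [exact: cvg_cst|exact: cvg_id].
Qed.

Let continuous_polar (trig : R -> R) : continuous trig -> continuous (fun y : R =>
  expR (- (gamma * complex.Re kappa) * y) * trig (- (gamma * complex.Im kappa) * y)).
Proof.
move=> ct y; apply: cvgM; apply: (continuous_scaled _ (a := _)) => //.
exact: continuous_expR.
Qed.

Let measurable_power (u : R -> R) : continuous u ->
  measurable_fun setT (fun b : R => u (b `^ (H * alpha))).
Proof.
move=> /continuous_measurable_fun mu_.
exact: (measurableT_comp mu_ (measurable_powR (H * alpha))).
Qed.

Let continuous_power (u : R -> R) (x : R) : continuous u -> 0 < x ->
  {for x, continuous (fun b : R => u (b `^ (H * alpha)))}.
Proof.
move=> cu x0; apply: continuous_comp; last exact: cu.
have [dp _] := is_derive1_powR (H * alpha) x0.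
exact/differentiable_continuous/derivable1_diffP.
Qed.

Let RehE : (fun b => complex.Re (h b)) = fun b => (fun y : R =>
  expR (- (gamma * complex.Re kappa) * y) * cos (- (gamma * complex.Im kappa) * y))
  (b `^ (H * alpha)).
Proof. by apply/funext => b; rewrite Re_cexp Re_exponent Im_exponent. Qed.

Let ImhE : (fun b => complex.Im (h b)) = fun b => (fun y : R =>
  expR (- (gamma * complex.Re kappa) * y) * sin (- (gamma * complex.Im kappa) * y))
  (b `^ (H * alpha)).
Proof. by apply/funext => b; rewrite Im_cexp Re_exponent Im_exponent. Qed.

Lemma self_similar_waiting_time :
  cintegral P [set: T] (fun w => cexp ('i%C * (xi * J 0%N w)%:C)) =
  lambda%:C * cintegral lebesgue_measure `[0, +oo[
    (fun w : R => cexp (- gamma%:C * kappa * (w `^ (H * alpha))%:C - (lambda * w)%:C)).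
Proof.
pose phi m (f : {ffun 'I_1 -> 'I_(ncell m).+1}) : R[i] :=
  \prod_(k < 1) h (grid m (f k)).
have phiE m f : phi m f = cintegral P setT (fun w => cexp ('i%C *
    (\sum_(k < 1) xi * (sigma (grid_time f k.+1) w - sigma (grid_time f k) w))%:C)).
  rewrite /phi big_ord1 -charfun_sigma ?grid_gt0//.
  apply/esym; apply: eq_dist_cintegral_cis.
  - apply: measurable_sum => i; apply: measurable_funM => //.
    by apply: measurable_funB; exact: m_RV.
  - by apply: measurable_funM => //; exact: m_RV.
  - move=> A mA.
    have mA' : measurable ((fun y : R => xi * y) @^-1` A).
      by rewrite -[X in measurable X]setTI; apply: measurable_funM.
    (* The shift is [0] here: this discards the term [sigma 0] of the first increment. *)
    have := sigma_stationary (ltW (grid_gt0 m (f ord0))) (lexx 0) mA'.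
    rewrite addr0 => e; transitivity
      (P (sigma (grid m (f ord0)) @^-1` ((fun y : R => xi * y) @^-1` A))) => //.
    rewrite -e; congr (P _); apply/seteqP; split => w /=;
      by rewrite big_ord1 grid_timeS grid_time0 add0r.
have lim1 := waiting_times_ccvg (c := fun _ : 'I_1 => xi) phiE.
transitivity (cintegral P setT (fun w => cexp ('i%C * (\sum_(k < 1) xi * J k w)%:C))).
  by congr cintegral; apply/funext => w; rewrite big_ord1.
apply: (ccvg_unique lim1).
have -> : (fun m => \sum_(f : {ffun 'I_1 -> 'I_(ncell m).+1})
    (\prod_(k < 1) exponential_mass lambda (cell m (f k)))%:C * phi m f) =
    fun m => \sum_(i < (ncell m).+1) (exponential_mass lambda (cell m i))%:C * h (grid m i).
  apply/funext => m.
  rewrite (sum_ffun_prod (fun i => exponential_mass lambda (cell m i))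
    (fun (_ : 'I_1) (i : 'I_(ncell m).+1) => h (grid m i))).
  by rewrite big_ord1.
have -> : (fun w : R => cexp (- gamma%:C * kappa * (w `^ (H * alpha))%:C - (lambda * w)%:C)) =
    fun w => h w * (expR (- (lambda * w)))%:C.
  by apply/funext => w; rewrite cexpD -cexp_real rmorphN.
apply: (@exponential_riemann_complex _ _ lambda_gt0 h 1).
- by rewrite RehE; exact: (measurable_power (continuous_polar (@continuous_cos R))).
- by rewrite ImhE; exact: (measurable_power (continuous_polar (@continuous_sin R))).
- by move=> x _; exact: norm_Re_cexp.
- by move=> x _; exact: norm_Im_cexp.
- by move=> x x0; rewrite RehE; exact: (continuous_power (continuous_polar (@continuous_cos R)) x0).
- by move=> x x0; rewrite ImhE; exact: (continuous_power (continuous_polar (@continuous_sin R)) x0).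
Qed.

End self_similar_stationary.

End waiting_times.

Theorem corollary3p6
    (R : realType) (d : measure_display) (T : measurableType d)
    (P : probability T R)
    (d' : measure_display) (S : measurableType d')
    (lambda : R) (lambda_gt0 : 0 < lambda)
    (Mt : nat -> {RV P >-> S}) (N : R -> {RV P >-> nat})
    (W : nat -> {RV P >-> R}) (M : R -> T -> S)
    (Mt_markov : markov_chain Mt)
    (N_poisson : poisson_process lambda N W)
    (Mt_N_indep : independent_systems P
       (sigma_gen [set: nat] Mt) (sigma_gen [set t : R | 0 <= t] N))
    (M_chain : jump_process P Mt N W M)
    (alpha H : R) (alpha_gt0 : 0 < alpha) (alpha_lt1 : alpha < 1)
    (sigma : R -> {RV P >-> R})
    (sigma_rc : right_continuous_paths P sigma)
    (sigma_stable : increasing_stable_process alpha sigma)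
    (sigma_ss : self_similar H sigma)
    (sigma_indep : independent_systems P
       (sigma_gen [set t : R | 0 <= t] sigma)
       <<s sigma_gen [set: nat] Mt `|` sigma_gen [set t : R | 0 <= t] N >>)
    (sigma_nodisc : no_fixed_discontinuity P sigma)
    (sigma0 : {ae P, forall w, sigma 0 w = 0})
    (psi : R -> T -> R) (psiE : psi = inverse_process sigma)
    (Y : R -> T -> S) (YE : Y = fun t w => M (psi t w) w)
    (J : nat -> {RV P >-> R})
    (J_waiting : jump_process P Mt (fun t w => N (psi t w) w) J Y) :
  (H = alpha^-1 ->
   forall nu : forall n : nat, 'I_n -> {charge set (n.-tuple R) -> \bar R},
   (forall (n : nat) (j : 'I_n) (A : set (n.-tuple R)),
      measurable A -> A `&` Omega n = set0 -> nu n j A = 0%E) ->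
   (forall (n : nat) (t : n.-tuple R), (0 < n)%N -> ordered_times t ->
      exists2 Gamma, spectral_measure alpha sigma t Gamma &
        forall A : set (n.-tuple R), measurable A ->
          Gamma A = (\sum_(j < n) (tnth t j)%:E * nu n j A)%E) ->
   forall (n : nat) (xi : 'cV[R]_n), (0 < n)%N ->
     char_fun P (fun k : 'I_n => J k) xi =
     \prod_(k < n)
       (lambda%:C /
        (lambda%:C + \sum_(j < n | (k <= j)%N)
           charge_cintegral (nu n j) (Omega n)
             (stable_kernel alpha ((A_mx n)^T *m xi)))))
  /\
  (stationary_increments sigma -> 0 < H -> H <= alpha^-1 ->
   (forall k : nat, eq_dist P (J k) (J 0%N)) /\
   (* The mass of Gamma1 is 1 when E e^{i xi sigma(1)} = e^{-(-i xi)^alpha}. *)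
   (forall Gamma1, spectral_measure alpha sigma [tuple 1] Gamma1 ->
    forall xi : R,
      cintegral P [set: T] (fun w => cexp ('i%C * (xi * J 0%N w)%:C)) =
      lambda%:C * cintegral lebesgue_measure `[0, +oo[
        (fun w : R =>
           cexp (- (fine (Gamma1 [set: 1.-tuple R]))%:C *
                   cpow (- 'i%C * xi%:C) alpha * (w `^ (H * alpha))%:C
                 - (lambda * w)%:C)))).
Proof.
subst psi.
have [sigma_lt spectral] := sigma_stable; have [_ NJ] := J_waiting.
split=> [_ nu _ nuP n xi n0|sigma_si _ _].
  apply: (stable_waiting_times lambda_gt0 N_poisson sigma_lt sigma_indep sigma0 NJ
    alpha_gt0 alpha_lt1) => t t_ordered; exact: nuP.
split=> [k|Gamma1 Gamma1P xi].
  exact: (stationary_waiting_times lambda_gt0 N_poisson sigma_lt sigma_indep sigma0 NJ).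
exact: (self_similar_waiting_time lambda_gt0 N_poisson sigma_lt sigma_indep sigma0 NJ).
Qed.
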